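(* Let $M^n$ be an $n$-dimensional pseudo-umbilical totally real submanifold in a complex space form $\tilde M^{n+p}(c)$ ($c\neq 0$) of complex dimension $n+p$ and constant holomorphic sectional curvature $c$. If the normal connection of $M^n$ is flat, then $M^n$ must be minimal.
   Context: A complex space form $\tilde M^{n+p}(c)$ is a Kähler manifold of complex dimension $n+p$, with complex structure $J$, of constant holomorphic sectional curvature $c$. It is non-flat when $c\ne 0$. An $n$-dimensional (real dimension $n$) submanifold $M^n$ is an immersed submanifold with the induced Riemannian metric. Let $h$ be its second fundamental form. Its mean curvature vector is $\zeta=\frac1n\operatorname{trace} h$, and $H=|\zeta|$. $M^n$ is totally real if $J(T_xM)\subset T_x^\perp M$ for every $x\in M$. $M^n$ is pseudo-umbilical if $\langle h(X,Y),\zeta\rangle=H^2\langle X,Y\rangle$ for all tangent vectors $X,Y$ at each point. $M^n$ is minimal if $\zeta\equiv 0$. The normal connection is flat if its curvature tensor (the normal curvature tensor) $R^\perp$ vanishes identically.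
   Formalization: The dimension of M^n is assumed to be n ≥ 2; for n = 1 the claim fails, since a non-geodesic circle in CP^1(c) is totally real, pseudo-umbilical and has flat normal connection but is not minimal. *)

(* Defs.v *)
From HB Require Import structures.
From mathcomp Require Import all_boot all_order all_algebra.
From mathcomp Require Import all_classical all_reals all_analysis.
Set Implicit Arguments.
Unset Strict Implicit.
Unset Printing Implicit Defensive.
Import Order.TTheory GRing.Theory Num.Theory.
Import numFieldNormedType.Exports.
Local Open Scope classical_set_scope.
Local Open Scope ring_scope.

(* Conventions. Tangent vectors are row vectors of components in a chart, and
   linear maps act on the right: [v *m 'J f y] is the differential of f at y
   applied to v, and [v *m J] is the value at v of the endomorphism J.
   Local expressions of functions, metrics and fields are total functions on
   ['rV_d], constrained only on the open set where they are meaningful; as that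
   set is open, derivatives at its points do not see the values outside. *)

Fixpoint class_C (R : realType) (V W : normedModType R) (k : nat)
    (U : set V) (f : V -> W) : Prop :=
  match k with
  | 0 => forall x, U x -> {for x, continuous f}
  | k'.+1 => (forall x, U x -> differentiable f x) /\
             (forall v : V, class_C k' U ('D_v f))
  end.

Definition smooth_on (R : realType) (V W : normedModType R)
    (U : set V) (f : V -> W) : Prop :=
  forall k, class_C k U f.

Record smoothManifold (R : realType) (d : nat) := SmoothManifold {
  points :> topologicalType;
  points_hausdorff : hausdorff_space points;
  points_second_countable : @second_countable points;
  chartIndex : Type;
  dom : chartIndex -> set points;
  chart : chartIndex -> points -> 'rV[R]_d;
  param : chartIndex -> 'rV[R]_d -> points;
  dom_cover : forall x, exists i, dom i x;
  dom_open : forall i, open (dom i);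
  chart_open : forall i, open (chart i @` dom i);
  chartK : forall i x, dom i x -> param i (chart i x) = x;
  chart_continuous : forall i x, dom i x -> {for x, continuous (chart i)};
  param_continuous : forall i y, (chart i @` dom i) y ->
    {for y, continuous (param i)};
  transition_smooth : forall i j,
    smooth_on (chart i @` (dom i `&` dom j)) (chart j \o param i)
}.
Arguments dom {R d s}.
Arguments chart {R d s}.
Arguments param {R d s}.

Definition codom_chart (R : realType) (d : nat) (M : smoothManifold R d)
    (i : chartIndex M) : set 'rV[R]_d :=
  chart i @` dom i.

Definition overlap (R : realType) (d : nat) (M : smoothManifold R d)
    (i j : chartIndex M) : set 'rV[R]_d :=
  chart i @` (dom i `&` dom j).

Definition transition (R : realType) (d : nat) (M : smoothManifold R d)
    (i j : chartIndex M) : 'rV[R]_d -> 'rV[R]_d :=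
  chart j \o param i.

Definition inner (R : realType) (d : nat) (G : 'M[R]_d) (u v : 'rV[R]_d) : R :=
  (u *m G *m v^T) 0 0.

(* The Christoffel symbols of the Levi-Civita connection of G, contracted with
   u and v: the components of nabla_u v when u and v have constant components. *)
Definition christoffel (R : realType) (d : nat) (G : 'rV[R]_d -> 'M[R]_d)
    (y u v : 'rV[R]_d) : 'rV[R]_d :=
  2^-1 *: (\row_(l < d)
     (inner ('D_u G y) v (delta_mx 0 l) + inner ('D_v G y) u (delta_mx 0 l)
        - inner ('D_(delta_mx 0 l) G y) u v)) *m invmx (G y).

(* R(u,v)w = nabla_u nabla_v w - nabla_v nabla_u w, for u, v, w extended with
   constant components (so that [u,v] = 0). *)
Definition curvature (R : realType) (d : nat) (G : 'rV[R]_d -> 'M[R]_d)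
    (y u v w : 'rV[R]_d) : 'rV[R]_d :=
  ('D_u (fun z => christoffel G z v w) y
     + christoffel G y u (christoffel G y v w))
  - ('D_v (fun z => christoffel G z u w) y
     + christoffel G y v (christoffel G y u w)).

Definition sectional_curvature (R : realType) (d : nat)
    (G : 'rV[R]_d -> 'M[R]_d) (y u v : 'rV[R]_d) : R :=
  inner (G y) (curvature G y u v v) u /
  (inner (G y) u u * inner (G y) v v - inner (G y) u v ^+ 2).

(* Kähler: almost Hermitian with J parallel for the Levi-Civita connection
   (integrability of J follows); m is the complex dimension. *)
Record kahlerManifold (R : realType) (m : nat) := KahlerManifold {
  kahler_mf :> smoothManifold R m.*2;
  metric : chartIndex kahler_mf -> 'rV[R]_m.*2 -> 'M[R]_m.*2;
  metric_smooth : forall i, smooth_on (codom_chart i) (metric i);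
  metric_sym : forall i y, codom_chart i y -> (metric i y)^T = metric i y;
  metric_pos : forall i y u, codom_chart i y -> u != 0 ->
    0 < inner (metric i y) u u;
  metric_transition : forall i j y, overlap i j y ->
    metric i y = 'J (transition i j) y *m metric j (transition i j y)
                   *m ('J (transition i j) y)^T;
  cplx : chartIndex kahler_mf -> 'rV[R]_m.*2 -> 'M[R]_m.*2;
  cplx_smooth : forall i, smooth_on (codom_chart i) (cplx i);
  cplx_transition : forall i j y, overlap i j y ->
    cplx i y *m 'J (transition i j) y =
    'J (transition i j) y *m cplx j (transition i j y);
  cplx_sqr : forall i y, codom_chart i y -> cplx i y *m cplx i y = - 1%:M;
  cplx_isometry : forall i y u v, codom_chart i y ->
    inner (metric i y) (u *m cplx i y) (v *m cplx i y) =
    inner (metric i y) u v;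
  (* (nabla_u J) v = nabla_u (J v) - J (nabla_u v) = 0 *)
  cplx_parallel : forall i y u v, codom_chart i y ->
    'D_u (fun z => v *m cplx i z) y
      + christoffel (metric i) y u (v *m cplx i y)
      - christoffel (metric i) y u v *m cplx i y = 0
}.
Arguments metric {R m k}.
Arguments cplx {R m k}.

Definition complex_space_form (R : realType) (m : nat) (N : kahlerManifold R m)
    (c : R) : Prop :=
  forall (i : chartIndex N) (y u : 'rV[R]_m.*2), codom_chart i y -> u != 0 ->
    sectional_curvature (metric i) y u (u *m cplx i y) = c.

(* G is the ambient metric and F the immersion, both read in charts. *)
Section LocalSubmanifold.
Context (R : realType) (n d : nat).
Variables (G : 'rV[R]_d -> 'M[R]_d) (F : 'rV[R]_n -> 'rV[R]_d).
Implicit Types (x u v : 'rV[R]_n) (w : 'rV[R]_d) (xi : 'rV[R]_n -> 'rV[R]_d).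

Definition induced_metric x : 'M[R]_n :=
  'J F x *m G (F x) *m ('J F x)^T.

Definition tangential_part x w : 'rV[R]_d :=
  w *m G (F x) *m ('J F x)^T *m invmx (induced_metric x) *m 'J F x.

Definition normal_part x w : 'rV[R]_d := w - tangential_part x w.

(* the ambient Levi-Civita connection on vector fields along F *)
Definition cov_along u xi x : 'rV[R]_d :=
  'D_u xi x + christoffel G (F x) ('D_u F x) (xi x).

Definition second_fundamental_form x u v : 'rV[R]_d :=
  normal_part x (cov_along u ('D_v F) x).

Definition mean_curvature_vector x : 'rV[R]_d :=
  n%:R^-1 *: \sum_(a < n) \sum_(b < n) invmx (induced_metric x) a b *:
    second_fundamental_form x (delta_mx 0 a) (delta_mx 0 b).

Definition mean_curvature x : R :=
  Num.sqrt (inner (G (F x)) (mean_curvature_vector x) (mean_curvature_vector x)).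

Definition normal_connection u xi x : 'rV[R]_d :=
  normal_part x (cov_along u xi x).

(* for u and v extended with constant components, so that [u,v] = 0 *)
Definition normal_curvature u v xi x : 'rV[R]_d :=
  normal_connection u (normal_connection v xi) x
  - normal_connection v (normal_connection u xi) x.

Definition normal_field (U : set 'rV[R]_n) xi : Prop :=
  smooth_on U xi /\
  forall x u, U x -> inner (G (F x)) (xi x) ('D_u F x) = 0.

End LocalSubmanifold.

Definition local_dom (R : realType) (n d : nat) (M : smoothManifold R n)
    (N : smoothManifold R d) (f : M -> N)
    (i : chartIndex M) (j : chartIndex N) : set 'rV[R]_n :=
  chart i @` (dom i `&` f @^-1` dom j).

Definition local_expr (R : realType) (n d : nat) (M : smoothManifold R n)
    (N : smoothManifold R d) (f : M -> N)
    (i : chartIndex M) (j : chartIndex N) : 'rV[R]_n -> 'rV[R]_d :=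
  chart j \o f \o param i.

Definition immersion (R : realType) (n d : nat) (M : smoothManifold R n)
    (N : smoothManifold R d) (f : M -> N) : Prop :=
  continuous f /\
  forall (i : chartIndex M) (j : chartIndex N),
    smooth_on (local_dom f i j) (local_expr f i j) /\
    forall x, local_dom f i j x -> row_free ('J (local_expr f i j) x).

Section Submanifold.
Context (R : realType) (n m : nat).
Variables (M : smoothManifold R n) (N : kahlerManifold R m) (f : M -> N).

Definition totally_real : Prop :=
  forall (i : chartIndex M) (j : chartIndex N) (x u v : 'rV[R]_n),
    local_dom f i j x ->
    let F := local_expr f i j in
    inner (metric j (F x)) ('D_u F x *m cplx j (F x)) ('D_v F x) = 0.

Definition pseudo_umbilical : Prop :=
  forall (i : chartIndex M) (j : chartIndex N) (x u v : 'rV[R]_n),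
    local_dom f i j x ->
    let F := local_expr f i j in
    let G := metric j in
    inner (G (F x)) (second_fundamental_form G F x u v)
                    (mean_curvature_vector G F x) =
    mean_curvature G F x ^+ 2 * inner (induced_metric G F x) u v.

Definition flat_normal_connection : Prop :=
  forall (i : chartIndex M) (j : chartIndex N) (xi : 'rV[R]_n -> 'rV[R]_m.*2),
    let F := local_expr f i j in
    let G := metric j in
    normal_field G F (local_dom f i j) xi ->
    forall x u v, local_dom f i j x -> normal_curvature G F u v xi x = 0.

Definition minimal : Prop :=
  forall (i : chartIndex M) (j : chartIndex N) (x : 'rV[R]_n),
    local_dom f i j x ->
    mean_curvature_vector (metric j) (local_expr f i j) x = 0.

End Submanifold.

(* Main.v *)
(* Write X_w for the tangent vector dF(w), J for the complex structure and k = c/4.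
   As M is totally real, the fields J X_w are normal, and flatness of the normal
   connection on these fields alone suffices. With A_r the shape operator of J X_r,
   the Ricci equation for J X_w is
     k (<X_r, X_w> J X_s - <X_s, X_w> J X_r) = B(r, A_s w) - B(s, A_r w).
   Pairing it with the mean curvature vector zeta, with J X_v and with an arbitrary
   normal vector gives, by pseudo-umbilicity and the total symmetry of <B(u, v), J X_w>:
   zeta is orthogonal to J(TM); [A_r, A_s] w = k (<r, w> s - <s, w> r);
   B(u, v) = J X_(A_u v) + <u, v> zeta; and tr A_r = 0.
   Then the Codazzi equation says that nabla A is totally symmetric, and the Gauss
   equation that the induced metric has curvature |zeta|^2. The bracket relation gives
   tr (A_u A_v) = k (n - 1) <u, v>, hence k > 0 and tr (nabla_r A_u A_v) = 0.
   Differentiating the latter once more and antisymmetrising yields an identity of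
   Simons type,
     tr (nabla_r A_u nabla_s A_v) - tr (nabla_s A_u nabla_r A_v)
       = k (n + 1) |zeta|^2 (<r, u> <s, v> - <s, u> <r, v>),
   whose contraction over an orthonormal basis is
     - |nabla A|^2 = k (n + 1) n (n - 1) |zeta|^2.  Hence zeta = 0. *)

Require Import Defs.
From HB Require Import structures.
From mathcomp Require Import all_boot all_order all_algebra.
From mathcomp Require Import all_classical all_reals all_analysis.
From mathcomp Require Import ring lra.
Set Implicit Arguments.
Unset Strict Implicit.
Unset Printing Implicit Defensive.
Import Order.TTheory GRing.Theory Num.Theory.
Import numFieldNormedType.Exports.
Local Open Scope classical_set_scope.
Local Open Scope ring_scope.

(** * Smooth matrix-valued functions *)

(** The pointwise relations leave the length of zeta undetermined. In the Gauss equation the bracket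
    [A_s, A_r] cancels the ambient curvature k exactly, so the induced metric is left with curvature
    |zeta|^2 and nothing contradicts zeta <> 0. The obstruction has to come from derivatives of A,
    whose second covariant derivatives commute up to this curvature. Of the field nabla_s nabla_r
    X_u only the components along X_w and J X_w are compared. There zeta enters through inner
    products with other terms, so it is never differentiated and |zeta|^2 may be treated as an
    arbitrary function. Pseudo-umbilicity is used once, to make zeta orthogonal to J(TM). That the
    remaining normal directions see only a multiple of the metric follows from the brackets: as k <>
    0 they give all infinitesimal rotations of the tangent space, and an operator commuting with
    these is scalar. The sign of k comes from tr (A_u A_u) >= 0, A_u being self-adjoint. *)

Section EntrywiseCalculus.
Context (R : realType) (V : normedModType R).

Lemma differentiable_mx (m n : nat) (M : V -> 'M[R]_(m, n)) x :
  differentiable M x <-> forall i j, differentiable (fun y => M y i j) x.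
Proof.
split=> [dM i j|dM].
  have := @differentiable_comp R V _ _ M (fun N : 'M[R]_(m, n) => N i j : R) x dM
    (differentiable_coord _ i j).
  exact.
have -> : M = \sum_(i < m) \sum_(j < n) (fun y => M y i j *: delta_mx i j).
  apply/funext => y; rewrite fct_sumE [LHS]matrix_sum_delta.
  by apply: eq_bigr => i _; rewrite fct_sumE.
apply: differentiable_sum => i; apply: differentiable_sum => j.
exact/differentiableZl.
Qed.

Lemma derive_entry (m n : nat) (M : V -> 'M[R]_(m, n)) x v i j :
  differentiable M x -> 'D_v (fun y => M y i j) x = ('D_v M x) i j.
Proof. by move=> dM; rewrite derive_mx ?mxE//; exact: diff_derivable. Qed.

Lemma derive_mulmx (m n p : nat) (A : V -> 'M[R]_(m, n)) (B : V -> 'M[R]_(n, p))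
    x v : differentiable A x -> differentiable B x ->
  'D_v (fun y => A y *m B y) x = 'D_v A x *m B x + A x *m 'D_v B x.
Proof.
move=> dA dB.
have dAB i j k : derivable (fun y => A y i k * B y k j) x v.
  by apply: derivableM; apply: diff_derivable; apply: (differentiable_mx _ _).1.
have EAB i j : (fun y => (A y *m B y) i j) =
    \sum_(k < n) (fun y => A y i k * B y k j).
  by apply/funext => y; rewrite fct_sumE mxE.
rewrite derive_mx; last first.
  apply/derivable_mxP => i j; rewrite EAB; exact: derivable_sum.
apply/matrixP => i j; rewrite !mxE EAB derive_sum// -big_split.
apply: eq_bigr => k _ /=; rewrite deriveM /=; last 2 first.
- exact/diff_derivable/(differentiable_mx _ _).1.
- exact/diff_derivable/(differentiable_mx _ _).1.
by rewrite (derive_entry _ _ _ dA) (derive_entry _ _ _ dB) addrC; congr (_ + _);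
  rewrite mulrC.
Qed.

Lemma differentiable_mulmx (m n p : nat) (A : V -> 'M[R]_(m, n))
    (B : V -> 'M[R]_(n, p)) x : differentiable A x -> differentiable B x ->
  differentiable (fun y => A y *m B y) x.
Proof.
move=> /differentiable_mx dA /differentiable_mx dB; apply/differentiable_mx => i j.
have -> : (fun y => (A y *m B y) i j) =
    \sum_(k < n) (fun y => A y i k * B y k j).
  by apply/funext => y; rewrite fct_sumE mxE.
by apply: differentiable_sum => k; exact: differentiableM.
Qed.

End EntrywiseCalculus.

(** * Stability of the classes C^k under algebraic operations and composition *)

Section ClassC.
Context (R : realType).

Lemma near_eq_differentiable (V W : normedModType R) (f g : V -> W) x :
  (\near x, f x = g x) -> differentiable f x -> differentiable g x.
Proof.
move=> fg df.
have dg : g \o shift x = cst (g x) + 'd f x +o_ 0 id.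
  apply/eqaddoP => e e0; have /eqaddoP/(_ e e0) := diff_locally df.
  have fg0 : \forall y \near 0, f (y + x) = g (y + x).
    by rewrite (near_shift x 0) /=; apply: filterS fg => y /=; rewrite sub0r subrK.
  apply: filterS2 fg0 => h fgh.
  by rewrite /= !fctE /= fgh (nbhs_singleton fg).
have Edg := diff_unique (diff_continuous df) dg.
apply/diff_locallyP; rewrite Edg; split => //; exact: diff_continuous.
Qed.

(** Formulas for derivatives hold on [U] only, whereas [class_C] speaks of total functions; as [U]
    is open, agreement on [U] passes to the derivatives there, which is what the inductions below
    rely on. *)
Lemma class_C_eq (V W : normedModType R) k (U : set V) (f g : V -> W) :
  open U -> (forall x, U x -> f x = g x) -> class_C k U f -> class_C k U g.
Proof.
move=> oU; elim: k f g => [|k IH] f g fg /=.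
  move=> fc x Ux; rewrite /prop_for /continuous_at -fg//.
  apply: cvg_trans (fc x Ux); apply: near_eq_cvg.
  have : nbhs x U by exact: open_nbhs_nbhs.
  by apply: filterS => y /fg.
move=> [df Df]; split=> [x Ux|v].
  apply: near_eq_differentiable (df x Ux).
  have : nbhs x U by exact: open_nbhs_nbhs.
  by apply: filterS => y /fg.
apply: IH (Df v) => x Ux; apply: near_eq_derive.
have : nbhs x U by exact: open_nbhs_nbhs.
by apply: filterS => y /fg.
Qed.

Lemma class_CS (V W : normedModType R) k (U : set V) (f : V -> W) :
  class_C k.+1 U f -> class_C k U f.
Proof.
elim: k f => [|k IH] f [df Df].
  by move=> x Ux; apply: differentiable_continuous; exact: df.
by split=> // v; apply: IH; exact: Df.
Qed.

Lemma class_C_cst (V W : normedModType R) k (U : set V) (w : W) :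
  class_C k U (fun _ : V => w).
Proof.
elim: k w => [|k IH] w; first by move=> x _; exact: cst_continuous.
split=> [x _|v]; first exact: differentiable_cst.
rewrite (_ : 'D_v _ = fun=> 0)//; apply/funext => x; exact: derive_cst.
Qed.

Lemma class_CD (V W : normedModType R) k (U : set V) (f g : V -> W) :
  open U -> class_C k U f -> class_C k U g -> class_C k U (fun x => f x + g x).
Proof.
move=> oU; elim: k f g => [|k IH] f g /=.
  by move=> fc gc x Ux; apply: cvgD; [exact: fc|exact: gc].
move=> [df Df] [dg Dg]; split=> [x Ux|v].
  by apply: differentiableD; [exact: df|exact: dg].
apply: class_C_eq (IH _ _ (Df v) (Dg v)) => // x Ux.
by rewrite deriveD//; apply: diff_derivable; [exact: df|exact: dg].
Qed.

Lemma class_CM (V : normedModType R) k (U : set V) (f g : V -> R) :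
  open U -> class_C k U f -> class_C k U g -> class_C k U (fun x => f x * g x).
Proof.
move=> oU; elim: k f g => [|k IH] f g.
  by move=> fc gc x Ux; apply: cvgM; [exact: fc|exact: gc].
move=> Cf Cg; have [df Df] := Cf; have [dg Dg] := Cg; split=> [x Ux|v].
  by apply: differentiableM; [exact: df|exact: dg].
have := class_CD oU (IH _ _ (class_CS Cf) (Dg v)) (IH _ _ (class_CS Cg) (Df v)).
apply: class_C_eq => // x Ux.
by rewrite deriveM//; apply: diff_derivable; [exact: df|exact: dg].
Qed.

Lemma class_CN (V : normedModType R) k (U : set V) (f : V -> R) :
  open U -> class_C k U f -> class_C k U (fun x => - f x).
Proof.
move=> oU Cf; apply: class_C_eq (class_CM oU (class_C_cst k U (-1 : R)) Cf) => //.
by move=> x _; rewrite mulN1r.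
Qed.

Lemma class_C_sum (V W : normedModType R) k (U : set V) (I : Type) (r : seq I)
    (P : pred I) (f : I -> V -> W) :
  open U -> (forall i, P i -> class_C k U (f i)) ->
  class_C k U (fun x => \sum_(i <- r | P i) f i x).
Proof.
move=> oU Cf; elim: r => [|i r IH].
  by under eq_fun do rewrite big_nil; exact: class_C_cst.
under eq_fun do rewrite big_cons; case: (boolP (P i)) => [Pi|_ //].
by apply: class_CD => //; exact: Cf.
Qed.

Lemma class_C_prod (V : normedModType R) k (U : set V) (I : Type) (r : seq I)
    (P : pred I) (f : I -> V -> R) :
  open U -> (forall i, P i -> class_C k U (f i)) ->
  class_C k U (fun x => \prod_(i <- r | P i) f i x).
Proof.
move=> oU Cf; elim: r => [|i r IH].
  by under eq_fun do rewrite big_nil; exact: class_C_cst.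
under eq_fun do rewrite big_cons; case: (boolP (P i)) => [Pi|_ //].
by apply: class_CM => //; exact: Cf.
Qed.

Lemma class_CV (V : normedModType R) k (U : set V) (f : V -> R) :
  open U -> (forall x, U x -> f x != 0) -> class_C k U f ->
  class_C k U (fun x => (f x)^-1).
Proof.
move=> oU f0; elim: k => [|k IH].
  by move=> fc x Ux; apply: cvgV; [exact: f0|exact: fc].
move=> Cf; have [df Df] := Cf; split=> [x Ux|v].
  by apply: differentiableV; [exact: df|exact: f0].
have Cfi := IH (class_CS Cf).
have := class_CN oU (class_CM oU (class_CM oU Cfi Cfi) (Df v)).
apply: class_C_eq => // x Ux.
rewrite deriveV ?f0//; last by apply: diff_derivable; exact: df.
by rewrite -exprVn expr2 -mulNr.
Qed.

Lemma class_C_mx (V : normedModType R) k (U : set V) m n (M : V -> 'M[R]_(m, n)) :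
  open U ->
  class_C k U M <-> forall i j, class_C k U (fun x => M x i j).
Proof.
move=> oU; elim: k M => [|k IH] M /=.
  split=> [MC i j x Ux|MC x Ux].
    exact: (continuous_comp (MC x Ux) (@coord_continuous R m n i j (M x))).
  apply/cvgrPdist_le => e e0; near=> y.
  rewrite /Num.Def.normr/= mx_normrE (bigmax_le _ (ltW e0))//= => i _.
  rewrite !mxE/=; move: i; near: y; apply: filter_forall => /= i.
  exact: (cvgrPdist_le _ _).1 (MC i.1 i.2 x Ux) e e0.
split=> [[dM DM] i j|CM].
  split=> [x Ux|v].
    by move/differentiable_mx: (dM x Ux); exact.
  have /IH/(_ i j) := DM v; apply: class_C_eq => // x Ux.
  by rewrite derive_entry//; exact: dM.
have dM x : U x -> differentiable M x.
  by move=> Ux; apply/differentiable_mx => i j; exact: (CM i j).1.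
split=> // v; apply/IH => i j.
have := (CM i j).2 v; apply: class_C_eq => // x Ux.
by rewrite derive_entry//; exact: dM.
Unshelve. all: by end_near. Qed.

Lemma derive_comp (V : normedModType R) d (F : V -> 'rV[R]_d) (W : normedModType R)
    (g : 'rV[R]_d -> W) x v :
  differentiable F x -> differentiable g (F x) ->
  'D_v (g \o F) x = 'D_('D_v F x) g (F x).
Proof.
move=> dF dg; rewrite deriveE; last exact: differentiable_comp.
by rewrite diff_comp//= -deriveE// -deriveE.
Qed.

Lemma derive_sum_coord d (W : normedModType R) (g : 'rV[R]_d -> W) x v :
  differentiable g x -> 'D_v g x = \sum_(i < d) v 0 i *: 'D_(delta_mx 0 i) g x.
Proof.
move=> dg; rewrite deriveE// {1}[v]row_sum_delta linear_sum.
by apply: eq_bigr => i _; rewrite linearZ/= deriveE.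
Qed.

(** The chain rule is written in coordinates, ['D_v (g \o F)] being a sum of products of entries of
    ['D_v F] with partial derivatives of [g] along [F], so that the induction hypothesis applies to
    each factor. *)
Lemma class_C_comp (V : normedModType R) k (U : set V) d (O : set 'rV[R]_d)
    (F : V -> 'rV[R]_d) (g : 'rV[R]_d -> R) :
  open U -> (forall x, U x -> O (F x)) -> class_C k U F -> class_C k O g ->
  class_C k U (g \o F).
Proof.
move=> oU UO; elim: k g => [|k IH] g.
  move=> FC gC x Ux.
  exact: (continuous_comp (FC x Ux) (gC (F x) (UO x Ux))).
move=> CF Cg; have [dF DF] := CF; have [dg Dg] := Cg; split=> [x Ux|v].
  by apply: differentiable_comp; [exact: dF|exact/dg/UO].
have : class_C k U (fun x => \sum_(i < d) 'D_v F x 0 i *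
    ('D_(delta_mx 0 i) g \o F) x).
  apply: class_C_sum => // i _; apply: class_CM => //.
    exact: ((class_C_mx _ _ oU).1 (DF v)).
  by apply: IH; [exact: class_CS|exact: Dg].
apply: class_C_eq => // x Ux.
by rewrite derive_comp ?derive_sum_coord//; [exact/dg/UO|exact: dF|exact/dg/UO].
Qed.

End ClassC.

(** * Symmetry of second derivatives *)

Lemma is_derive_line (R : realType) (V W : normedModType R) (f : V -> W) y u (s : R) :
  differentiable f (s *: u + y) ->
  is_derive s 1 (fun r : R => f (r *: u + y)) ('D_u f (s *: u + y)).
Proof.
move=> df; have E : (fun h : R => h^-1 *:
      (((fun r : R => f (r *: u + y)) \o shift s) (h *: (1 : R)) - f (s *: u + y))) =
    (fun h => h^-1 *: ((f \o shift (s *: u + y)) (h *: u) - f (s *: u + y))).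
  by apply/funext => h /=; rewrite [h *: 1]mulr1 scalerDl addrA.
by apply: DeriveDef; rewrite /derivable /derive E //; exact: diff_derivable.
Qed.

(** The mean value theorem along [u], applied to the difference of [f] on two parallel segments a
    distance [t *: v] apart, turns the second difference into [t] times an increment of ['D_u f],
    which is then linearised at [x]. *)
Lemma second_difference (R : realType) (V : normedModType R) (f : V -> R) x u v e :
  (\near x, differentiable f x) -> differentiable ('D_u f) x -> 0 < e ->
  \forall t \near 0^'+, `|f (t *: u + (x + t *: v)) - f (t *: u + x)
     - f (x + t *: v) + f x - t ^+ 2 * 'D_v ('D_u f) x| <= e * t ^+ 2.
Proof.
move=> df dDf e0.
pose N := `|u| + `|v| + 1.
have N0 : 0 < N by rewrite /N; have := normr_ge0 u; have := normr_ge0 v; lra.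
(* Two increments of ['D_u f] get estimated, each with error at most [e' * (t * N)]; this choice
   makes the total [e * t]. *)
pose e' := e / (2 * N).
have e'0 : 0 < e' by rewrite divr_gt0// mulr_gt0.
have /eqaddoP/(_ e' e'0)/nbhs_ballP[d1 /= d10 H1] := diff_locally dDf.
have /nbhs_ballP[d2 /= d20 H2] := df.
pose d := Num.min d1 d2 / N.
have d0 : 0 < d by rewrite divr_gt0// lt_min d10 d20.
near=> t.
have t0 : 0 < t by [].
have td : t * N < Num.min d1 d2 by rewrite -ltr_pdivlMr.
have small a b : `|a| <= t -> `|b| <= t -> `|a *: u + b *: v| <= t * N.
  move=> at_ bt; apply: le_trans (ler_normD _ _) _; rewrite !normrZ /N.
  have := ler_wpM2r (normr_ge0 u) at_; have := ler_wpM2r (normr_ge0 v) bt; nra.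
have dfs a b : `|a| <= t -> `|b| <= t -> differentiable f (a *: u + (x + b *: v)).
  move=> at_ bt; apply: H2; rewrite -ball_normE /= addrCA opprD addNKr normrN.
  by apply: le_lt_trans (small a b at_ bt) _; apply: lt_le_trans td _; rewrite ge_min lexx orbT.
have est a b : `|a| <= t -> `|b| <= t ->
    `|'D_u f (a *: u + (x + b *: v)) - 'D_u f x - 'd ('D_u f) x (a *: u + b *: v)|
      <= e' * (t * N).
  move=> at_ bt; have sm := small a b at_ bt; have := H1 (a *: u + b *: v).
  rewrite -ball_normE /= sub0r normrN !fctE /= => H.
  have -> : a *: u + (x + b *: v) = a *: u + b *: v + x by rewrite [x + _]addrC addrA.
  apply: le_trans (_ : _ <= e' * `|a *: u + b *: v|) _; last by rewrite ler_pM2l.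
  rewrite -addrA -opprD; apply: H.
  by apply: le_lt_trans sm _; apply: lt_le_trans td _; rewrite ge_min lexx.
pose g := fun r : R => f (r *: u + (x + t *: v)) - f (r *: u + x).
pose dg := fun r : R => 'D_u f (r *: u + (x + t *: v)) - 'D_u f (r *: u + x).
have t1 : `|t| <= t by rewrite gtr0_norm.
have g_der r : 0 <= r -> r <= t -> is_derive r 1 g (dg r).
  move=> r0 rt; have r1 : `|r| <= t by rewrite ger0_norm.
  apply: is_deriveB; apply: is_derive_line; first exact: dfs.
  by have := dfs r 0 r1; rewrite scale0r addr0 normr0; apply; exact: ltW.
have [||c + Ec] := @MVT R g dg 0 t t0.
- by move=> r; rewrite in_itv /= => /andP[r0 rt]; apply: g_der; exact: ltW.
- apply: derivable_within_continuous => r; rewrite in_itv /= => /andP[r0 rt].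
  by have [] := g_der r r0 rt.
rewrite in_itv /= => /andP[c0 ct].
have c1 : `|c| <= t by rewrite gtr0_norm// ltW.
have z1 : `|0 : R| <= t by rewrite normr0 ltW.
have A := est c t c1 t1; have B := est c 0 c1 z1.
move: B; rewrite scale0r !addr0 => B.
have Edg : dg c - t * 'D_v ('D_u f) x =
   ('D_u f (c *: u + (x + t *: v)) - 'D_u f x - 'd ('D_u f) x (c *: u + t *: v))
   - ('D_u f (c *: u + x) - 'D_u f x - 'd ('D_u f) x (c *: u)).
  have EL : 'd ('D_u f) x (t *: v) = t * 'd ('D_u f) x v by exact: linearZ.
  rewrite /dg (deriveE v dDf) linearD EL.
  ring.
have {}Edg : `|dg c - t * 'D_v ('D_u f) x| <= e * t.
  rewrite Edg; apply: le_trans (ler_normB _ _) _.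
  apply: le_trans (lerD A B) _; rewrite /e' le_eqVlt; apply/orP; left; apply/eqP.
  by field; rewrite gt_eqF.
have -> : f (t *: u + (x + t *: v)) - f (t *: u + x) - f (x + t *: v) + f x
    - t ^+ 2 * 'D_v ('D_u f) x = t * (dg c - t * 'D_v ('D_u f) x).
  rewrite mulrBr [t * dg c]mulrC; move: Ec; rewrite subr0 => <-.
  rewrite /g !scale0r !add0r; ring.
by rewrite normrM gtr0_norm// expr2 mulrCA ler_pM2l.
Unshelve. all: by end_near. Qed.

(** The second difference is symmetric in [u] and [v], and divided by [t ^+ 2] it tends to both
    iterated derivatives. *)
Lemma derive_comm (R : realType) (V : normedModType R) (f : V -> R) x u v :
  (\near x, differentiable f x) ->
  differentiable ('D_u f) x -> differentiable ('D_v f) x ->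
  'D_v ('D_u f) x = 'D_u ('D_v f) x.
Proof.
move=> df dDu dDv; apply/eqP; rewrite -subr_eq0 -normr_le0.
apply/ler_addgt0Pl => e e0; rewrite addr0.
have e2 : 0 < e / 2 by rewrite divr_gt0.
have HA := second_difference v df dDu e2.
have HB := second_difference u df dDv e2.
have : \forall t \near (0 : R)^'+, `|'D_v ('D_u f) x - 'D_u ('D_v f) x| <= e.
  apply: filterS3 (nbhs_right_gt (0 : R)) HA HB => t /= t0 A B.
  have t20 : 0 < t ^+ 2 by rewrite exprn_gt0.
  move: ('D_v ('D_u f) x) ('D_u ('D_v f) x) A B => a b A B.
  rewrite -(ler_pM2r t20) -[X in _ * X](gtr0_norm t20) -normrM.
  apply: le_trans (_ : _ <= e / 2 * t ^+ 2 + e / 2 * t ^+ 2) _; last by rewrite -mulrDl -splitr.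
  apply: le_trans (lerD B A); apply: le_trans (ler_normB _ _).
  rewrite [t *: v + (x + _)]addrCA [t *: u + (x + _)]addrCA.
  rewrite [t *: v + t *: u]addrC [x + t *: u]addrC [x + t *: v]addrC.
  by rewrite le_eqVlt; apply/orP; left; apply/eqP; congr `|_|; ring.
by move/filter_ex => [].
Qed.

(** * Closure properties of smooth functions on an open set *)

Section Smooth.
Context (R : realType) (V : normedModType R) (U : set V) (oU : open U).

Lemma smooth_eq (W : normedModType R) (f g : V -> W) :
  (forall x, U x -> f x = g x) -> smooth_on U f -> smooth_on U g.
Proof. by move=> fg Cf k; apply: class_C_eq fg _. Qed.

Lemma smooth_differentiable (W : normedModType R) (f : V -> W) x :
  smooth_on U f -> U x -> differentiable f x.
Proof. by move=> /(_ 1) [df _]; exact: df. Qed.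

Lemma smooth_derive (W : normedModType R) (f : V -> W) v :
  smooth_on U f -> smooth_on U ('D_v f).
Proof. by move=> Cf k; have [_ Df] := Cf k.+1; exact: Df. Qed.

Lemma smooth_cst (W : normedModType R) (w : W) : smooth_on U (fun _ => w).
Proof. by move=> k; exact: class_C_cst. Qed.

Lemma smoothD (W : normedModType R) (f g : V -> W) :
  smooth_on U f -> smooth_on U g -> smooth_on U (fun x => f x + g x).
Proof. by move=> Cf Cg k; exact: class_CD. Qed.

Lemma smoothM (f g : V -> R) :
  smooth_on U f -> smooth_on U g -> smooth_on U (fun x => f x * g x).
Proof. by move=> Cf Cg k; exact: class_CM. Qed.

Lemma smooth_sum (W : normedModType R) (I : Type) (r : seq I) (P : pred I)
    (f : I -> V -> W) : (forall i, P i -> smooth_on U (f i)) ->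
  smooth_on U (fun x => \sum_(i <- r | P i) f i x).
Proof. by move=> Cf k; apply: class_C_sum => // i Pi; exact: Cf. Qed.

Lemma smooth_prod (I : Type) (r : seq I) (P : pred I)
    (f : I -> V -> R) : (forall i, P i -> smooth_on U (f i)) ->
  smooth_on U (fun x => \prod_(i <- r | P i) f i x).
Proof. by move=> Cf k; apply: class_C_prod => // i Pi; exact: Cf. Qed.

Lemma smoothV (f : V -> R) : (forall x, U x -> f x != 0) ->
  smooth_on U f -> smooth_on U (fun x => (f x)^-1).
Proof. by move=> f0 Cf k; exact: class_CV. Qed.

Lemma smooth_mx m n (M : V -> 'M[R]_(m, n)) :
  smooth_on U M <-> forall i j, smooth_on U (fun x => M x i j).
Proof.
split=> [CM i j k|CM k].
  exact: ((class_C_mx k M oU).1 (CM k)).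
by apply/(class_C_mx k M oU) => i j; exact: CM.
Qed.

Lemma smooth_mulmx m n p (A : V -> 'M[R]_(m, n)) (B : V -> 'M[R]_(n, p)) :
  smooth_on U A -> smooth_on U B -> smooth_on U (fun x => A x *m B x).
Proof.
move=> /smooth_mx CA /smooth_mx CB; apply/smooth_mx => i j.
under eq_fun do rewrite mxE.
by apply: smooth_sum => k _; exact: smoothM.
Qed.

Lemma smooth_trmx m n (A : V -> 'M[R]_(m, n)) :
  smooth_on U A -> smooth_on U (fun x => (A x)^T).
Proof.
move=> /smooth_mx CA; apply/smooth_mx => i j.
by under eq_fun do rewrite mxE; exact: CA.
Qed.

Lemma smoothZ m n (f : V -> R) (A : V -> 'M[R]_(m, n)) :
  smooth_on U f -> smooth_on U A -> smooth_on U (fun x => f x *: A x).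
Proof.
move=> Cf /smooth_mx CA; apply/smooth_mx => i j.
by under eq_fun do rewrite mxE; exact: smoothM.
Qed.

Lemma smoothN m n (A : V -> 'M[R]_(m, n)) :
  smooth_on U A -> smooth_on U (fun x => - A x).
Proof.
move=> CA; apply: smooth_eq (smoothZ (smooth_cst (-1 : R)) CA) => x _.
by rewrite scaleN1r.
Qed.

Lemma smoothB m n (A B : V -> 'M[R]_(m, n)) :
  smooth_on U A -> smooth_on U B -> smooth_on U (fun x => A x - B x).
Proof. by move=> CA CB; apply: smoothD => //; exact: smoothN. Qed.

Lemma smooth_det n (A : V -> 'M[R]_n) :
  smooth_on U A -> smooth_on U (fun x => \det (A x)).
Proof.
move=> /smooth_mx CA; apply: smooth_sum => s _; apply: smoothM.
  exact: smooth_cst.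
by apply: smooth_prod => i _; exact: CA.
Qed.

Lemma smooth_invmx n (A : V -> 'M[R]_n) :
  (forall x, U x -> A x \in unitmx) ->
  smooth_on U A -> smooth_on U (fun x => invmx (A x)).
Proof.
move=> uA CA.
have : smooth_on U (fun x => (\det (A x))^-1 *: \adj (A x)).
  apply: smoothZ.
    apply: smoothV; last exact: smooth_det.
    by move=> x /uA; rewrite unitmxE unitfE.
  apply/smooth_mx => i j; under eq_fun do rewrite mxE.
  apply: smoothM; first exact: smooth_cst.
  apply: smooth_det; apply/smooth_mx => a b; under eq_fun do rewrite !mxE.
  by move/smooth_mx : CA; exact.
by apply: smooth_eq => x /uA ux; rewrite /invmx ux.
Qed.

Lemma smooth_comp d (O : set 'rV[R]_d) (F : V -> 'rV[R]_d) m n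
    (g : 'rV[R]_d -> 'M[R]_(m, n)) :
  open O -> (forall x, U x -> O (F x)) -> smooth_on U F -> smooth_on O g ->
  smooth_on U (g \o F).
Proof.
move=> oO UO CF Cg; apply/smooth_mx => i j k.
exact: (class_C_comp oU UO (CF k) ((class_C_mx k g oO).1 (Cg k) i j)).
Qed.

Lemma derive_comm_mx m n (A : V -> 'M[R]_(m, n)) x u v :
  smooth_on U A -> U x -> 'D_v ('D_u A) x = 'D_u ('D_v A) x.
Proof.
move=> CA Ux; have nU : nbhs x U by exact: open_nbhs_nbhs.
have dA y : U y -> differentiable A y by exact: smooth_differentiable.
have E (w z : V) i j : ('D_w ('D_z A) x) i j = 'D_w ('D_z (fun y => A y i j)) x.
  rewrite -derive_entry; last exact: smooth_differentiable (smooth_derive _ CA) Ux.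
  apply: near_eq_derive; apply: filterS nU => y Uy.
  by rewrite -derive_entry//; exact: dA.
apply/matrixP => i j; apply: etrans (E v u i j) _; apply: esym.
apply: etrans (E u v i j) _; have Cij := (smooth_mx A).1 CA i j.
apply: derive_comm.
- by apply: filterS nU => y Uy; exact: smooth_differentiable Uy.
- exact: smooth_differentiable (smooth_derive _ Cij) Ux.
- exact: smooth_differentiable (smooth_derive _ Cij) Ux.
Qed.

End Smooth.

Lemma smooth_jacobian (R : realType) n d (U : set 'rV[R]_n) (F : 'rV[R]_n -> 'rV[R]_d) :
  open U -> smooth_on U F -> smooth_on U (fun x => 'J F x).
Proof.
move=> oU CF; apply/(smooth_mx oU) => i j.
have := (smooth_mx oU _).1 (smooth_derive (delta_mx 0 i) CF) 0 j.
apply: smooth_eq => // x Ux; rewrite deriveEjacobian.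
  by rewrite -rowE mxE.
exact: smooth_differentiable Ux.
Qed.

(** * Leibniz rules *)

Section ProductRules.
Context (R : realType) (V : normedModType R).

Lemma derive_bigsum (W : normedModType R) n (f : 'I_n -> V -> W) x v :
  (forall i, differentiable (f i) x) ->
  'D_v (fun y => \sum_(i < n) f i y) x = \sum_(i < n) 'D_v (f i) x.
Proof.
move=> df; rewrite -derive_sum; last by move=> i; exact: diff_derivable.
by congr ('D_v _ x); apply/funext => y; rewrite fct_sumE.
Qed.

Lemma differentiable_bigsum (W : normedModType R) n (f : 'I_n -> V -> W) x :
  (forall i, differentiable (f i) x) ->
  differentiable (fun y => \sum_(i < n) f i y) x.
Proof.
move=> df; have -> : (fun y => \sum_(i < n) f i y) = \sum_(i < n) f i.
  by apply/funext => y; rewrite fct_sumE.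
exact: differentiable_sum.
Qed.

Lemma differentiable_scalemx m n (f : V -> R) (A : V -> 'M[R]_(m, n)) x :
  differentiable f x -> differentiable A x ->
  differentiable (fun y => f y *: A y) x.
Proof.
move=> df /differentiable_mx dA; apply/differentiable_mx => i j.
under eq_fun do rewrite mxE.
by apply: differentiableM.
Qed.

Lemma derive_scalemx m n (f : V -> R) (A : V -> 'M[R]_(m, n)) x v :
  differentiable f x -> differentiable A x ->
  'D_v (fun y => f y *: A y) x = 'D_v f x *: A x + f x *: 'D_v A x.
Proof.
move=> df dA; apply/matrixP => i j.
rewrite -derive_entry; last exact: differentiable_scalemx.
under eq_fun do rewrite mxE.
have dAij : differentiable (fun y => A y i j) x by move/differentiable_mx: dA; exact.
rewrite deriveM; [|exact: diff_derivable..].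
by rewrite derive_entry// !mxE addrC; congr (_ + _); exact: mulrC.
Qed.

Lemma derive_trmx m n (A : V -> 'M[R]_(m, n)) x v :
  differentiable A x -> 'D_v (fun y => (A y)^T) x = ('D_v A x)^T.
Proof.
move=> dA; apply/matrixP => i j.
rewrite -derive_entry; last first.
  apply/differentiable_mx => k l; under eq_fun do rewrite mxE.
  by move/differentiable_mx: dA; exact.
by under eq_fun do rewrite mxE; rewrite derive_entry// mxE.
Qed.

Lemma deriveM_fun (f g : V -> R) x v : differentiable f x -> differentiable g x ->
  'D_v (fun y => f y * g y) x = 'D_v f x * g x + f x * 'D_v g x.
Proof.
move=> df dg; rewrite deriveM; [|exact: diff_derivable..].
by rewrite addrC; congr (_ + _); exact: mulrC.
Qed.

Definition bilin a b (W : lmodType R) (B : 'rV[R]_a -> 'rV[R]_b -> W) : Prop :=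
  (forall c u u' w, B (c *: u + u') w = c *: B u w + B u' w) /\
  (forall c u w w', B u (c *: w + w') = c *: B u w + B u w').

Lemma lin_row_sum a (W : lmodType R) (f : 'rV[R]_a -> W) u :
  (forall c v w, f (c *: v + w) = c *: f v + f w) ->
  f u = \sum_(i < a) u 0 i *: f (delta_mx 0 i).
Proof.
move=> lf; have f0 : f 0 = 0.
  have := lf 1 0 0; rewrite !scale1r addr0 => /eqP.
  by rewrite -subr_eq0 opprD addNKr oppr_eq0 => /eqP.
rewrite {1}[u]row_sum_delta; elim: (index_enum _) => [|i s IH].
  by rewrite !big_nil f0.
by rewrite !big_cons lf IH.
Qed.

Lemma bilin_expand a b (W : lmodType R) (B : 'rV[R]_a -> 'rV[R]_b -> W) u w :
  bilin B ->
  B u w = \sum_(i < a) \sum_(j < b)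
    (u 0 i * w 0 j) *: B (delta_mx 0 i) (delta_mx 0 j).
Proof.
move=> [Bl Br]; rewrite (lin_row_sum u (fun c v v' => Bl c v v' w)).
apply: eq_bigr => i _; rewrite (lin_row_sum w (fun c v v' => Br c _ v v')).
by rewrite scaler_sumr; apply: eq_bigr => j _; rewrite scalerA.
Qed.

(** Meant for Christoffel terms along a map, where the base point and both arguments vary together.
    Expansion in the standard bases reduces it to the product rule for scalars. *)
Lemma bilin_derive (U : set V) a b p q (B : V -> 'rV[R]_a -> 'rV[R]_b -> 'M[R]_(p, q))
    (f : V -> 'rV[R]_a) (g : V -> 'rV[R]_b) x v :
  open U -> U x -> (forall y, U y -> bilin (B y)) ->
  (forall i j, differentiable (fun y => B y (delta_mx 0 i) (delta_mx 0 j)) x) ->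
  differentiable f x -> differentiable g x ->
  'D_v (fun y => B y (f y) (g y)) x =
  'D_v (fun y => B y (f x) (g x)) x + B x ('D_v f x) (g x) + B x (f x) ('D_v g x).
Proof.
move=> oU Ux bB dB df dg.
have nU : nbhs x U by exact: open_nbhs_nbhs.
have dfi i : differentiable (fun y => f y 0 i) x by move/differentiable_mx : df; exact.
have dgi i : differentiable (fun y => g y 0 i) x by move/differentiable_mx : dg; exact.
have E f' g' : 'D_v (fun y => B y (f' y) (g' y)) x = 'D_v (fun y =>
    \sum_(i < a) \sum_(j < b) (f' y 0 i * g' y 0 j) *:
       B y (delta_mx 0 i) (delta_mx 0 j)) x.
  by apply: near_eq_derive; apply: filterS nU => y Uy; rewrite bilin_expand//; exact: bB.
have D (f' : V -> 'rV[R]_a) (g' : V -> 'rV[R]_b) : (forall i, differentiable (fun y => f' y 0 i) x) ->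
    (forall i, differentiable (fun y => g' y 0 i) x) ->
    'D_v (fun y => B y (f' y) (g' y)) x = \sum_(i < a) \sum_(j < b)
    (('D_v (fun y => f' y 0 i) x * g' x 0 j + f' x 0 i * 'D_v (fun y => g' y 0 j) x) *:
        B x (delta_mx 0 i) (delta_mx 0 j) +
     (f' x 0 i * g' x 0 j) *: 'D_v (fun y => B y (delta_mx 0 i) (delta_mx 0 j)) x).
  move=> df' dg'; rewrite E derive_bigsum; last first.
    move=> i; apply: differentiable_bigsum => j; apply: differentiable_scalemx => //.
    exact: differentiableM.
  apply: eq_bigr => i _; rewrite derive_bigsum; last first.
    by move=> j; apply: differentiable_scalemx => //; exact: differentiableM.
  apply: eq_bigr => j _; rewrite derive_scalemx//; last exact: differentiableM.
  by rewrite deriveM_fun.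
rewrite (D f g)// (D (fun=> f x) (fun=> g x)); [|by move=> i; exact: differentiable_cst..].
rewrite (bilin_expand ('D_v f x) (g x) (bB x Ux)) (bilin_expand (f x) ('D_v g x) (bB x Ux)).
rewrite -!big_split /=; apply: eq_bigr => i _; rewrite -!big_split /=.
apply: eq_bigr => j _; rewrite !derive_cst mul0r mulr0 addr0 scale0r add0r.
by rewrite (derive_entry v 0 i df) (derive_entry v 0 j dg) scalerDl [LHS]addrC addrA.
Qed.

End ProductRules.

Lemma bilin_smooth (R : realType) (V : normedModType R) (U : set V) a b p q
    (B : V -> 'rV[R]_a -> 'rV[R]_b -> 'M[R]_(p, q)) (f : V -> 'rV[R]_a) (g : V -> 'rV[R]_b) :
  open U -> (forall y, U y -> bilin (B y)) ->
  (forall i j, smooth_on U (fun y => B y (delta_mx 0 i) (delta_mx 0 j))) ->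
  smooth_on U f -> smooth_on U g -> smooth_on U (fun y => B y (f y) (g y)).
Proof.
move=> oU bB CB Cf Cg.
have : smooth_on U (fun y => \sum_(i < a) \sum_(j < b) (f y 0 i * g y 0 j) *:
       B y (delta_mx 0 i) (delta_mx 0 j)).
  apply: smooth_sum => // i _; apply: smooth_sum => // j _; apply: smoothZ => //.
  apply: smoothM => //; first exact: ((smooth_mx oU f).1 Cf 0 i).
  exact: ((smooth_mx oU g).1 Cg 0 j).
by apply: smooth_eq => // y Uy; rewrite -bilin_expand//; exact: bB.
Qed.

(* [der], [ip], [chr] and [cov] seal the corresponding notions of the definitions:
   when two instances fail to unify, Rocq would otherwise unfold both of them down
   to limits and matrix products, which takes forever. *)
HB.lock Definition der (R : realType) (V W : normedModType R) (v : V) (f : V -> W)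
  (x : V) : W := 'D_v f x.

HB.lock Definition ip (R : realType) d (G : 'M[R]_d) (u v : 'rV[R]_d) : R := inner G u v.

HB.lock Definition chr (R : realType) d (G : 'rV[R]_d -> 'M[R]_d)
  (y u v : 'rV[R]_d) : 'rV[R]_d := christoffel G y u v.

HB.lock Definition cov (R : realType) n d (G : 'rV[R]_d -> 'M[R]_d)
  (F : 'rV[R]_n -> 'rV[R]_d) (u : 'rV[R]_n) (xi : 'rV[R]_n -> 'rV[R]_d)
  (x : 'rV[R]_n) : 'rV[R]_d := cov_along G F u xi x.

Lemma derE (R : realType) (V W : normedModType R) (v : V) (f : V -> W) :
  der v f = 'D_v f.
Proof. by rewrite unlock. Qed.

Lemma covE (R : realType) n d (G : 'rV[R]_d -> 'M[R]_d) (F : 'rV[R]_n -> 'rV[R]_d) u xi x :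
  cov G F u xi x = der u xi x + chr G (F x) (der u F x) (xi x).
Proof. by rewrite [cov]unlock [chr]unlock derE /cov_along derE. Qed.

Lemma curvatureE (R : realType) d (G : 'rV[R]_d -> 'M[R]_d) y u v w :
  curvature G y u v w =
    (der u (fun z => chr G z v w) y + chr G y u (chr G y v w))
    - (der v (fun z => chr G z u w) y + chr G y v (chr G y u w)).
Proof. by rewrite /curvature [chr]unlock !derE. Qed.

Lemma derive_inner (R : realType) (V : normedModType R) d (G : V -> 'M[R]_d)
    (a b : V -> 'rV[R]_d) x v :
  differentiable G x -> differentiable a x -> differentiable b x ->
  'D_v (fun y => inner (G y) (a y) (b y)) x =
    inner ('D_v G x) (a x) (b x) + inner (G x) ('D_v a x) (b x)
      + inner (G x) (a x) ('D_v b x).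
Proof.
move=> dG da db; rewrite /inner.
have dT : differentiable (fun y => (b y)^T) x.
  apply/differentiable_mx => i j; under eq_fun do rewrite mxE.
  by move/differentiable_mx: db; exact.
have daG : differentiable (fun y => a y *m G y) x by exact: differentiable_mulmx.
rewrite derive_entry; last exact: differentiable_mulmx.
by rewrite !derive_mulmx// derive_trmx// mulmxDl !mxE [X in X + _]addrC.
Qed.

Section SealedDerivative.
Context (R : realType) (V : normedModType R) (U : set V) (oU : open U).

Lemma smooth_der (W : normedModType R) (f : V -> W) v :
  smooth_on U f -> smooth_on U (der v f).
Proof. by rewrite derE; exact: smooth_derive. Qed.

Lemma der_lin (W : normedModType R) (f : V -> W) x c u u' : smooth_on U f -> U x ->
  der (c *: u + u') f x = c *: der u f x + der u' f x.
Proof.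
move=> Cf Ux; have df := smooth_differentiable Cf Ux.
by rewrite !derE !deriveE// linearP.
Qed.

Lemma der_cst (W : normedModType R) (w : W) (v x : V) : der v (fun _ => w) x = 0.
Proof. by rewrite derE; exact: derive_cst. Qed.

Lemma der_id v x : der v (fun y : V => y) x = v.
Proof. by rewrite derE; exact: derive_id. Qed.

Lemma smooth_id : smooth_on U (fun y : V => y).
Proof.
case=> [|k]; first by move=> x _; exact: cvg_id.
split=> [x _|v]; first by have [] := is_diff_id x.
have -> : 'D_v (fun y : V => y) = fun=> v.
  by apply/funext => x; rewrite derive_id.
exact: class_C_cst.
Qed.

Lemma der_eq (W : normedModType R) (f g : V -> W) v x :
  (forall y, U y -> f y = g y) -> U x -> der v f x = der v g x.
Proof.
move=> fg Ux; rewrite !derE; apply: near_eq_derive.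
have : nbhs x U by exact: open_nbhs_nbhs.
by apply: filterS => y; exact: fg.
Qed.

Lemma derD (W : normedModType R) (f g : V -> W) v x :
  smooth_on U f -> smooth_on U g -> U x ->
  der v (fun y => f y + g y) x = der v f x + der v g x.
Proof.
move=> Cf Cg Ux; rewrite !derE.
have df : derivable f x v := diff_derivable (smooth_differentiable Cf Ux).
have dg : derivable g x v := diff_derivable (smooth_differentiable Cg Ux).
exact: (deriveD df dg).
Qed.

Lemma der_scalemx m n (f : V -> R) (A : V -> 'M[R]_(m, n)) v x :
  smooth_on U f -> smooth_on U A -> U x ->
  der v (fun y => f y *: A y) x = der v f x *: A x + f x *: der v A x.
Proof.
move=> Cf CA Ux; rewrite !derE; apply: derive_scalemx.
  exact: smooth_differentiable Ux.
exact: smooth_differentiable Ux.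
Qed.

Lemma der_mulmx m n p (A : V -> 'M[R]_(m, n)) (B : V -> 'M[R]_(n, p)) v x :
  smooth_on U A -> smooth_on U B -> U x ->
  der v (fun y => A y *m B y) x = der v A x *m B x + A x *m der v B x.
Proof.
move=> CA CB Ux; rewrite !derE; apply: derive_mulmx.
  exact: smooth_differentiable Ux.
exact: smooth_differentiable Ux.
Qed.

Lemma der_trmx m n (A : V -> 'M[R]_(m, n)) v x : smooth_on U A -> U x ->
  der v (fun y => (A y)^T) x = (der v A x)^T.
Proof.
by move=> CA Ux; rewrite !derE derive_trmx//; exact: smooth_differentiable Ux.
Qed.

Lemma der_ip d (G : V -> 'M[R]_d) (a b : V -> 'rV[R]_d) v x :
  smooth_on U G -> smooth_on U a -> smooth_on U b -> U x ->
  der v (fun y => ip (G y) (a y) (b y)) x =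
    ip (der v G x) (a x) (b x) + ip (G x) (der v a x) (b x)
      + ip (G x) (a x) (der v b x).
Proof.
move=> CG Ca Cb Ux; rewrite [ip]unlock !derE; apply: derive_inner.
- exact: smooth_differentiable Ux.
- exact: smooth_differentiable Ux.
- exact: smooth_differentiable Ux.
Qed.

Lemma der_comm m n (A : V -> 'M[R]_(m, n)) u v x : smooth_on U A -> U x ->
  der v (der u A) x = der u (der v A) x.
Proof. by move=> CA Ux; rewrite !derE; exact: (derive_comm_mx oU u v CA Ux). Qed.

Lemma der_comm_fun (f : V -> R) u v x : smooth_on U f -> U x ->
  der v (der u f) x = der u (der v f) x.
Proof.
move=> Cf Ux; rewrite !derE; apply: derive_comm.
- have : nbhs x U by exact: open_nbhs_nbhs.
  by apply: filterS => y; exact: smooth_differentiable.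
- exact: smooth_differentiable (smooth_derive _ Cf) Ux.
- exact: smooth_differentiable (smooth_derive _ Cf) Ux.
Qed.

Lemma der_bilin a b p q (B : V -> 'rV[R]_a -> 'rV[R]_b -> 'M[R]_(p, q))
    (f : V -> 'rV[R]_a) (g : V -> 'rV[R]_b) x v :
  (forall y, U y -> bilin (B y)) ->
  (forall i j, smooth_on U (fun y => B y i j)) ->
  smooth_on U f -> smooth_on U g -> U x ->
  der v (fun y => B y (f y) (g y)) x =
  der v (fun y => B y (f x) (g x)) x + B x (der v f x) (g x) + B x (f x) (der v g x).
Proof.
move=> bB CB Cf Cg Ux; rewrite !derE; apply: (bilin_derive v oU Ux bB).
- by move=> i j; exact: smooth_differentiable Ux.
- exact: smooth_differentiable Ux.
- exact: smooth_differentiable Ux.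
Qed.

Lemma der_comp d (O : set 'rV[R]_d) (W : normedModType R) (F : V -> 'rV[R]_d)
    (g : 'rV[R]_d -> W) v x :
  (forall x, U x -> O (F x)) -> smooth_on U F -> smooth_on O g -> U x ->
  der v (fun y => g (F y)) x = der (der v F x) g (F x).
Proof.
move=> UO CF Cg Ux; rewrite !derE; apply: (derive_comp (F := F) (g := g)).
  exact: smooth_differentiable Ux.
exact: smooth_differentiable (UO x Ux).
Qed.

Lemma smooth_ip d (G : V -> 'M[R]_d) (a b : V -> 'rV[R]_d) :
  smooth_on U G -> smooth_on U a -> smooth_on U b ->
  smooth_on U (fun y => ip (G y) (a y) (b y)).
Proof.
move=> CG Ca Cb; rewrite [ip]unlock.
have := smooth_mulmx oU (smooth_mulmx oU Ca CG) (smooth_trmx oU Cb).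
by move=> /(smooth_mx oU) /(_ 0 0).
Qed.

End SealedDerivative.

(** * Bilinear forms given by matrices *)

Section Inner.
Context (R : realType) (d : nat).
Implicit Types (G H : 'M[R]_d) (u v w : 'rV[R]_d).

Lemma ipE G u v : ip G u v = (u *m G *m v^T) 0 0.
Proof. by rewrite unlock. Qed.

Lemma ipDl G u u' v : ip G (u + u') v = ip G u v + ip G u' v.
Proof. by rewrite !ipE !mulmxDl mxE. Qed.

Lemma ipDr G u v v' : ip G u (v + v') = ip G u v + ip G u v'.
Proof. by rewrite !ipE linearD mulmxDr mxE. Qed.

Lemma ipZl G c u v : ip G (c *: u) v = c * ip G u v.
Proof. by rewrite !ipE -!scalemxAl mxE. Qed.

Lemma ipZr G c u v : ip G u (c *: v) = c * ip G u v.
Proof. by rewrite !ipE linearZ -scalemxAr mxE. Qed.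

Lemma ipNl G u v : ip G (- u) v = - ip G u v.
Proof. by rewrite -scaleN1r ipZl mulN1r. Qed.

Lemma ipNr G u v : ip G u (- v) = - ip G u v.
Proof. by rewrite -scaleN1r ipZr mulN1r. Qed.

Lemma ipBl G u u' v : ip G (u - u') v = ip G u v - ip G u' v.
Proof. by rewrite ipDl ipNl. Qed.

Lemma ipBr G u v v' : ip G u (v - v') = ip G u v - ip G u v'.
Proof. by rewrite ipDr ipNr. Qed.

Lemma ip0l G v : ip G 0 v = 0.
Proof. by rewrite -(scale0r 0) ipZl mul0r. Qed.

Lemma ip0r G v : ip G v 0 = 0.
Proof. by rewrite -(scale0r 0) ipZr mul0r. Qed.

Lemma ip_suml G (I : Type) (r : seq I) (P : pred I) (f : I -> 'rV[R]_d) v :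
  ip G (\sum_(i <- r | P i) f i) v = \sum_(i <- r | P i) ip G (f i) v.
Proof. exact: (big_morph (ip G ^~ v) (fun a b => ipDl G a b v) (ip0l G v)). Qed.

Lemma ipC G u v : G^T = G -> ip G u v = ip G v u.
Proof.
move=> sG; rewrite !ipE; transitivity ((u *m G *m v^T)^T 0 0).
  by rewrite [RHS]mxE.
by rewrite !trmx_mul trmxK sG mulmxA.
Qed.

Lemma ipDG G H u v : ip (G + H) u v = ip G u v + ip H u v.
Proof. by rewrite !ipE mulmxDr mulmxDl mxE. Qed.

Lemma ipZG c G u v : ip (c *: G) u v = c * ip G u v.
Proof. by rewrite !ipE -scalemxAr -scalemxAl mxE. Qed.

Lemma ip_inj G u v : G \in unitmx -> (forall w, ip G u w = ip G v w) -> u = v.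
Proof.
move=> uG E; apply: (can_inj (mulmxK uG)); apply/rowP => j.
by have := E (delta_mx 0 j); rewrite !ipE trmx_delta -!colE !mxE.
Qed.

Lemma posdef_unitmx G : (forall u, u != 0 -> 0 < ip G u u) -> G \in unitmx.
Proof.
move=> pG; rewrite -row_free_unit -kermx_eq0; apply/rowV0P => v /sub_kermxP vG.
by apply/eqP/negP => /negP/pG; rewrite ipE vG mul0mx mxE ltxx.
Qed.

End Inner.

Lemma ip_mulmx (R : realType) n d (G : 'M[R]_d) (A : 'M[R]_(n, d)) (u v : 'rV[R]_n) :
  ip (A *m G *m A^T) u v = ip G (u *m A) (v *m A).
Proof. by rewrite !ipE trmx_mul !mulmxA. Qed.

Lemma mxDE (R : nmodType) m n (A B : 'M[R]_(m, n)) i j : (A + B) i j = A i j + B i j.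
Proof. by rewrite mxE. Qed.

Lemma mxNE (R : zmodType) m n (A : 'M[R]_(m, n)) i j : (- A) i j = - A i j.
Proof. by rewrite mxE. Qed.

(** * The Levi-Civita connection along a map *)

Section Christoffel.
Context (R : realType) (d : nat) (O : set 'rV[R]_d) (G : 'rV[R]_d -> 'M[R]_d).
Hypotheses (oO : open O) (CG : smooth_on O G)
  (symG : forall y, O y -> (G y)^T = G y)
  (posG : forall y u, O y -> u != 0 -> 0 < ip (G y) u u).

Lemma metric_unit y : O y -> G y \in unitmx.
Proof. by move=> Oy; apply: posdef_unitmx => u; exact: posG. Qed.

Lemma der_metric_sym y u : O y -> (der u G y)^T = der u G y.
Proof. by move=> Oy; rewrite -(der_trmx u CG Oy); exact: (der_eq oO). Qed.

(** Koszul's formula for fields with constant components. Symmetry, bilinearity and metric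
    compatibility of the Christoffel symbols are all read off from it. *)
Lemma chr_ip y u v w : O y ->
  ip (G y) (chr G y u v) w = 2^-1 *
    (ip (der u G y) v w + ip (der v G y) u w - ip (der w G y) u v).
Proof.
move=> Oy; rewrite [chr]unlock /christoffel -scalemxAl ipZl; congr (_ * _).
rewrite ipE mulmxKV ?metric_unit// mxE.
(* The row in [christoffel] lists the values of a linear form on the standard basis; [L] recovers
   the form at [w]. *)
have L (f : 'rV[R]_d -> R) : (forall c a b, f (c *: a + b) = c * f a + f b) ->
    \sum_(j < d) f (delta_mx 0 j) * w 0 j = f w.
  move=> lf; rewrite (@lin_row_sum R d R^o f w lf).
  by apply: eq_bigr => j _; rewrite mulrC.
rewrite -(L (fun w => ip (der u G y) v w + ip (der v G y) u w
  - ip (der w G y) u v)).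
  by apply: eq_bigr => j _; rewrite !mxE [ip]unlock !derE.
move=> c a b; rewrite (der_lin c a b CG Oy).
by rewrite !ipDr !ipZr ipDG ipZG; ring.
Qed.

Lemma chr_sym y u v : O y -> chr G y u v = chr G y v u.
Proof.
move=> Oy; apply: (ip_inj (metric_unit Oy)) => w; rewrite !chr_ip//.
by rewrite (ipC u v (der_metric_sym w Oy)); ring.
Qed.

Lemma chr_bilin y : O y -> bilin (chr G y).
Proof.
move=> Oy; have uG := metric_unit Oy.
have Bl c u u' w : chr G y (c *: u + u') w =
    c *: chr G y u w + chr G y u' w.
  apply: (ip_inj uG) => z; rewrite ipDl ipZl !chr_ip//.
  by rewrite (der_lin c u u' CG Oy) ipDG ipZG !ipDl !ipZl; ring.
by split=> // c u w w'; rewrite !(chr_sym u)// Bl.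
Qed.

Lemma chrDr y a b c : O y -> chr G y a (b + c) = chr G y a b + chr G y a c.
Proof. by move=> /chr_bilin[_ Br]; rewrite -[b]scale1r Br !scale1r. Qed.

Lemma chr_smooth u v : smooth_on O (fun y => chr G y u v).
Proof.
have Ci a w z : smooth_on O (fun y => ip (der a G y) w z).
  apply: (smooth_ip oO); first exact: smooth_der.
    exact: smooth_cst.
  exact: smooth_cst.
have Cr : smooth_on O (fun y => \row_(l < d)
     (ip (der u G y) v (delta_mx 0 l) + ip (der v G y) u (delta_mx 0 l)
        - ip (der (delta_mx 0 l) G y) u v)).
  apply/(smooth_mx oO) => i j; under eq_fun do rewrite mxE.
  apply: (smoothD oO); first by apply: (smoothD oO).
  apply: (@smooth_eq _ _ O oO _ (fun y => -1 * ip (der (delta_mx 0 j) G y) u v)).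
    by move=> x _; rewrite mulN1r.
  by apply: (smoothM oO) => //; exact: smooth_cst.
have := smooth_mulmx oO (smoothZ oO (smooth_cst O (2^-1 : R)) Cr)
  (smooth_invmx oO metric_unit CG).
apply: (smooth_eq oO) => y Oy; rewrite [chr]unlock /christoffel.
by congr (_ *: _ *m _); apply/rowP => l; rewrite !mxE [ip]unlock !derE.
Qed.

Lemma chr_compat y u v w : O y ->
  ip (der u G y) v w = ip (G y) (chr G y u v) w + ip (G y) v (chr G y u w).
Proof.
move=> Oy; rewrite (ipC v _ (symG Oy)) !chr_ip//.
rewrite (ipC w v (der_metric_sym u Oy)).
by field.
Qed.

Section AlongMap.
Context (n : nat) (U : set 'rV[R]_n) (F : 'rV[R]_n -> 'rV[R]_d).
Hypotheses (oU : open U) (CF : smooth_on U F) (UO : forall x, U x -> O (F x)).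
Implicit Types xi eta : 'rV[R]_n -> 'rV[R]_d.

Lemma smooth_chr_along xi eta : smooth_on U xi -> smooth_on U eta ->
  smooth_on U (fun x => chr G (F x) (xi x) (eta x)).
Proof.
move=> Cx Ce; apply: (bilin_smooth (B := fun x => chr G (F x))) => //.
  by move=> x Ux; apply: chr_bilin; exact: UO.
move=> i j; apply: (smooth_comp oU oO UO CF (chr_smooth _ _)).
Qed.

Lemma smooth_cov u xi : smooth_on U xi -> smooth_on U (cov G F u xi).
Proof.
move=> Cx; have := smoothD oU (smooth_der u Cx) (smooth_chr_along (smooth_der u CF) Cx).
by apply: (smooth_eq oU) => x _; rewrite covE.
Qed.

Lemma der_ip_along u xi eta x : smooth_on U xi -> smooth_on U eta -> U x ->
  der u (fun y => ip (G (F y)) (xi y) (eta y)) x =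
  ip (G (F x)) (cov G F u xi x) (eta x) + ip (G (F x)) (xi x) (cov G F u eta x).
Proof.
move=> Cx Ce Ux.
have CGF : smooth_on U (fun y => G (F y)) by exact: (smooth_comp oU oO UO CF CG).
rewrite (der_ip u CGF Cx Ce Ux) (der_comp u UO CF CG Ux).
rewrite !covE ipDl ipDr chr_compat; last exact: UO.
by ring.
Qed.

Lemma covD u xi eta x : smooth_on U xi -> smooth_on U eta -> U x ->
  cov G F u (fun y => xi y + eta y) x = cov G F u xi x + cov G F u eta x.
Proof.
move=> Cx Ce Ux; rewrite !covE (derD u Cx Ce Ux) chrDr; last exact: UO.
by rewrite addrACA.
Qed.

Lemma cov_torsion u v x : U x -> cov G F u (der v F) x = cov G F v (der u F) x.
Proof.
move=> Ux; rewrite !covE (der_comm oU v u CF Ux).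
by rewrite (chr_sym (der u F x) _ (UO Ux)).
Qed.

(** The directions [s] and [r] are constant, so there is no bracket term. In the expansion [D] of
    [cov (cov xi)], the second derivatives of [xi] and [F] are symmetric in the two directions, and
    so are, taken together, the two terms with one derivative of [xi]; what survives
    antisymmetrisation is the coordinate expression of the curvature at [F x]. *)
Lemma cov_curvature s r xi x : smooth_on U xi -> U x ->
  cov G F s (cov G F r xi) x - cov G F r (cov G F s xi) x
  = curvature G (F x) (der s F x) (der r F x) (xi x).
Proof.
move=> Cx Ux; have Oy := UO Ux.
have D a b : cov G F a (cov G F b xi) x =
   der a (der b xi) x
   + (der (der a F x) (fun z => chr G z (der b F x) (xi x)) (F x)
    + chr G (F x) (der a (der b F) x) (xi x)
    + chr G (F x) (der b F x) (der a xi x))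
   + (chr G (F x) (der a F x) (der b xi x)
     + chr G (F x) (der a F x) (chr G (F x) (der b F x) (xi x))).
  rewrite covE.
  have Cc : smooth_on U (fun x => chr G (F x) (der b F x) (xi x)).
    by apply: smooth_chr_along => //; exact: smooth_der.
  have -> : cov G F b xi = fun y => der b xi y + chr G (F y) (der b F y) (xi y).
    by apply/funext => y; rewrite covE.
  rewrite (derD a (smooth_der b Cx) Cc Ux) chrDr//.
  rewrite (der_bilin (B := fun x => chr G (F x)) oU); last 5 first.
  - by move=> y Uy; apply: chr_bilin; exact: UO.
  - by move=> i j; exact: (smooth_comp oU oO UO CF (chr_smooth _ _)).
  - exact: smooth_der.
  - exact: Cx.
  - exact: Ux.
  by rewrite (der_comp a UO CF (chr_smooth (der b F x) (xi x)) Ux).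
rewrite !D curvatureE (der_comm oU r s Cx Ux) (der_comm oU r s CF Ux).
by apply/rowP => l; rewrite !(mxDE, mxNE); ring.
Qed.

End AlongMap.
End Christoffel.

(** * Curvature of complex space forms *)

Section KahlerCurvatureAlgebra.
Context (R : realFieldType) (V : zmodType) (J : V -> V) (T : V -> V -> V -> V -> R).
Hypotheses (JD : forall u v, J (u + v) = J u + J v) (JJ : forall u, J (J u) = - u)
  (TD : forall u u' v w z, T (u + u') v w z = T u v w z + T u' v w z)
  (TC12 : forall u v w z, T u v w z = - T v u w z)
  (TC34 : forall u v w z, T u v w z = - T u v z w)
  (T_bianchi : forall u v w z, T u v w z + T v w u z + T w u v z = 0)
  (TJ : forall u v w z, T u v (J w) (J z) = T u v w z)
  (T_hol : forall u, T u (J u) (J u) u = 0).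

(** The classical octahedron argument: four cyclic identities combined with the two skew
    symmetries. *)
Let T_pair u v w z : T u v w z = T w z u v.
Proof.
have B1 := T_bianchi u v w z; have B2 := T_bianchi v w z u.
have B3 := T_bianchi w z u v; have B4 := T_bianchi z u v w.
have := TC34 u v w z; have := TC34 v w u z; have := TC34 w u v z.
have := TC34 v w z u; have := TC34 w z v u; have := TC34 z v w u.
have := TC34 w z u v; have := TC34 z u w v; have := TC34 u w z v.
have := TC34 z u v w; have := TC34 u v z w; have := TC34 v z u w.
have := TC12 u w v z; have := TC12 u w z v; have := TC12 v z u w; have := TC12 v z w u.
lra.
Qed.

Let TD2 u v v' w z : T u (v + v') w z = T u v w z + T u v' w z.
Proof. by rewrite TC12 TD (TC12 v) (TC12 v'); ring. Qed.

Let TD3 u v w w' z : T u v (w + w') z = T u v w z + T u v w' z.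
Proof. by rewrite T_pair TD -!(T_pair u v). Qed.

Let TD4 u v w z z' : T u v w (z + z') = T u v w z + T u v w z'.
Proof. by rewrite T_pair TD2 -!(T_pair u v). Qed.

Let TN u v w z : T (- u) v w z = - T u v w z.
Proof.
have T0 : T 0 v w z = 0 by have := TD 0 0 v w z; rewrite addr0; lra.
by have := TD u (- u) v w z; rewrite subrr T0; lra.
Qed.

Let TN2 u v w z : T u (- v) w z = - T u v w z.
Proof. by rewrite TC12 TN -TC12. Qed.

Let TN3 u v w z : T u v (- w) z = - T u v w z.
Proof. by rewrite T_pair TN -T_pair. Qed.

Let TN4 u v w z : T u v w (- z) = - T u v w z.
Proof. by rewrite T_pair TN2 -T_pair. Qed.

Let TJ12 u v w z : T (J u) (J v) w z = T u v w z.
Proof. by rewrite T_pair TJ -T_pair. Qed.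

Let JN u : J (- u) = - J u.
Proof. by rewrite -{1}(JJ u) JJ. Qed.

(* Polarisation of [T_hol], from its values at [x + y] and [x - y]. *)
Let hol2 x y : 3 * T x (J y) (J y) x + T x y y x = 0.
Proof.
have Hp := T_hol (x + y); have Hm := T_hol (x + - y).
have Hx := T_hol x; have Hy := T_hol y.
move: Hp Hm; rewrite !JD !JN !(TD, TD2, TD3, TD4) !(TN, TN2, TN3, TN4) => Hp Hm.
have E1 p q : T y (J x) p q = T x (J y) p q.
  by rewrite -TJ12 JJ TN2 -TC12.
have E2 p q : T p q (J x) y = T p q (J y) x.
  by rewrite -TJ JJ TN3 -TC34.
have E3 : T y (J y) (J x) x = T x (J x) (J y) y by rewrite T_pair TC12 TC34; ring.
have E4 := T_bianchi x (J x) (J y) y; have E5 := TJ12 x y x y.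
have E6 := TC34 x y x y; have E7 := TC12 (J y) x (J x) y.
have := E1 (J x) y; have := E1 (J y) x; have := E2 x (J y); lra.
Qed.

(** Applied to [y] and to [J y], [hol2] gives two linear relations between [T x y y x] and
    [T x (J y) (J y) x], with determinant 3 * 3 - 1 = 8. *)
Let sec0 x y : T x y y x = 0.
Proof.
have := hol2 x y; have := hol2 x (J y); rewrite JJ TN2 TN3; lra.
Qed.

(** Polarising [sec0] twice makes [T] skew in its outer slots ([A], then [C]), hence invariant under
    cyclic permutations of the first three ([E]); the Bianchi identity then reads 3 T = 0. *)
Lemma kahler_curvature_eq0 u v w z : T u v w z = 0.
Proof.
have A x y z' : T x y z' x = 0.
  have := sec0 x (y + z'); rewrite TD2 !TD3 !sec0.
  have : T x z' y x = T x y z' x by rewrite T_pair TC12 TC34 opprK.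
  lra.
have C x y p q : T x y p q = - T q y p x.
  by have := A (x + q) y p; rewrite TD !TD4 !A; lra.
have E x y p q : T x y p q = T p x y q.
  by have := C x y p q; have := TC12 q y p x; have := T_pair y q p x; lra.
by have := T_bianchi u v w z; have := E u v w z; have := E v w u z; lra.
Qed.

End KahlerCurvatureAlgebra.

(** The model tensor [T0] has all the symmetries of a Kaehler curvature tensor, and the factor
    [c / 4] gives it the prescribed value c |u|^4 on the plane of [u] and [J u], where its terms add
    up to 4 |u|^4. The difference [T] is therefore killed by [kahler_curvature_eq0]. *)
Lemma const_hol_tensor (R : realFieldType) (V : zmodType) (J : V -> V) (g : V -> V -> R)
    (Rm : V -> V -> V -> V) (c : R) :
  (forall u v, J (u + v) = J u + J v) -> (forall u, J (J u) = - u) ->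
  (forall u v, g u v = g v u) -> (forall u v w, g (u + v) w = g u w + g v w) ->
  (forall u v, g (J u) (J v) = g u v) ->
  (forall u u' v w, Rm (u + u') v w = Rm u v w + Rm u' v w) ->
  (forall u v w, Rm u v w = - Rm v u w) ->
  (forall u v w z, g (Rm u v w) z = - g w (Rm u v z)) ->
  (forall u v w, Rm u v w + Rm v w u + Rm w u v = 0) ->
  (forall u v w, Rm u v (J w) = J (Rm u v w)) ->
  (forall u, g (Rm u (J u) (J u)) u = c * g u u ^+ 2) ->
  forall u v w z, g (Rm u v w) z = c / 4 * (g v w * g u z - g u w * g v z
     + g (J v) w * g (J u) z - g (J u) w * g (J v) z + 2 * g u (J v) * g (J w) z).
Proof.
move=> JD JJ gC gDl gJJ RD RC Rskew Rbianchi RJ Rhol u v w z.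
have g0 e : g 0 e = 0 by have := gDl 0 0 e; rewrite addr0; lra.
have gNl a e : g (- a) e = - g a e.
  by have := gDl a (- a) e; rewrite subrr g0; lra.
have gNr a e : g e (- a) = - g e a by rewrite gC gNl gC.
have gJ a e : g (J a) e = - g a (J e) by rewrite -(gJJ a) JJ gNr opprK.
pose T0 a b p q := c / 4 * (g b p * g a q - g a p * g b q
   + g (J b) p * g (J a) q - g (J a) p * g (J b) q + 2 * g a (J b) * g (J p) q).
pose T a b p q := g (Rm a b p) q - T0 a b p q.
suff : T u v w z = 0 by rewrite /T => /eqP; rewrite subr_eq0 => /eqP.
apply: (@kahler_curvature_eq0 R V J T JD JJ).
- by move=> a a' b p q; rewrite /T /T0 RD !gDl JD !gDl; ring.
- by move=> a b p q; rewrite /T /T0 (RC a) gNl (gC b (J a)) (gJ a b); ring.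
- move=> a b p q; rewrite /T /T0 Rskew (gC p (Rm _ _ _)) (gJ q p) (gC q (J p)).
  by ring.
- move=> a b p q; have /(congr1 (g ^~ q)) := Rbianchi a b p; rewrite !gDl g0 => E.
  have : T0 a b p q + T0 b p a q + T0 p a b q = 0.
    rewrite /T0 (gC p a) (gC p b) (gC b a) (gC p (J a)) (gC b (J p)) (gC a (J b)).
    by rewrite (gJ a p) (gJ p b) (gJ b a) (gC p (J b)) (gC a (J p)) (gC b (J a));
      rewrite (gJ a b) (gJ p a) (gJ b p); ring.
  by rewrite /T; lra.
- by move=> a b p q; rewrite /T /T0 RJ !gJJ (gJ b p) (gJ a q) (gJ a p) (gJ b q); ring.
- move=> a; have a0 : g a (J a) = 0 by have := gJ a a; rewrite gC; lra.
  by rewrite /T Rhol /T0 !gJJ !gJ !JJ !gNr a0; field.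
Qed.

(** * Symmetries of the curvature of a Kaehler metric *)

Section CurvatureTensor.
Context (R : realType) (d : nat) (O : set 'rV[R]_d) (G : 'rV[R]_d -> 'M[R]_d).
Hypotheses (oO : open O) (CG : smooth_on O G)
  (symG : forall y, O y -> (G y)^T = G y)
  (posG : forall y u, O y -> u != 0 -> 0 < ip (G y) u u).
Implicit Types u v w z : 'rV[R]_d.

Let idO (y : 'rV[R]_d) : O y -> O y := id.
Let Cid : smooth_on O (fun y : 'rV[R]_d => y) := smooth_id O.

(** The ambient connection is the connection along the identity map, so [cov_curvature] with [F] the
    identity presents the curvature as a commutator of covariant derivatives. *)
Lemma curvature_cov y u v w : O y -> curvature G y u v w =
  cov G (fun z => z) u (cov G (fun z => z) v (fun _ => w)) y
  - cov G (fun z => z) v (cov G (fun z => z) u (fun _ => w)) y.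
Proof.
move=> Oy; have := cov_curvature oO CG symG posG oO Cid idO u v (smooth_cst O w) Oy.
by rewrite !der_id => ->.
Qed.

Lemma curvatureC y u v w : curvature G y u v w = - curvature G y v u w.
Proof. by rewrite /curvature opprB. Qed.

(** The second derivatives of the function [<w, z>], with [w] and [z] of constant components,
    commute; expanded by metric compatibility, this is the claim. *)
Lemma curvature_skew y u v w z : O y ->
  ip (G y) (curvature G y u v w) z = - ip (G y) w (curvature G y u v z).
Proof.
move=> Oy; rewrite !curvature_cov//.
have Cc a : smooth_on O (fun _ : 'rV[R]_d => a : 'rV[R]_d) by exact: smooth_cst.
have Cv a b : smooth_on O (cov G (fun z => z) a (fun _ => b)).
  exact: (smooth_cov oO CG symG posG oO Cid idO).
have D := der_ip_along oO CG symG posG oO Cid idO.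
have D1 a t : O t -> der a (fun y => ip (G y) w z) t =
    ip (G t) (cov G (fun z => z) a (fun _ => w) t) z +
    ip (G t) w (cov G (fun z => z) a (fun _ => z) t).
  by move=> Ot; exact: (D a _ _ _ (Cc w) (Cc z) Ot).
have Cg a b : smooth_on O a -> smooth_on O b -> smooth_on O (fun y => ip (G y) (a y) (b y)).
  exact: (smooth_ip oO).
have D2 a b : der a (der b (fun y => ip (G y) w z)) y =
    ip (G y) (cov G (fun z => z) a (cov G (fun z => z) b (fun _ => w)) y) z +
    ip (G y) (cov G (fun z => z) b (fun _ => w) y) (cov G (fun z => z) a (fun _ => z) y) +
    (ip (G y) (cov G (fun z => z) a (fun _ => w) y) (cov G (fun z => z) b (fun _ => z) y)
    + ip (G y) w (cov G (fun z => z) a (cov G (fun z => z) b (fun _ => z)) y)).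
  rewrite (der_eq oO a (D1 b) Oy).
  rewrite (derD a (Cg _ _ (Cv b w) (Cc z)) (Cg _ _ (Cc w) (Cv b z)) Oy).
  by rewrite (D a _ _ _ (Cv b w) (Cc z) Oy) (D a _ _ _ (Cc w) (Cv b z) Oy).
have := der_comm_fun oO u v (Cg _ _ (Cc w) (Cc z)) Oy.
rewrite !D2 !ipBl !ipBr; lra.
Qed.

Lemma curvature_bianchi y u v w : O y ->
  curvature G y u v w + curvature G y v w u + curvature G y w u v = 0.
Proof.
move=> Oy; have E a b c : der a (fun z => chr G z b c) y = der a (fun z => chr G z c b) y.
  by apply: (der_eq oO) => // z Oz; exact: (chr_sym oO CG symG posG).
have S := chr_sym oO CG symG posG.
rewrite !curvatureE (E u w v) (E v w u) (E w v u) (S y w u)// (S y w v)// (S y v u)//.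
by apply/rowP => l; rewrite !(mxDE, mxNE) [RHS]mxE; ring.
Qed.

Lemma curvatureDl y u u' v w : O y ->
  curvature G y (u + u') v w = curvature G y u v w + curvature G y u' v w.
Proof.
move=> Oy; rewrite !curvatureE.
have [Bl Br] := chr_bilin oO CG symG posG Oy.
have Cc a b : smooth_on O (fun y => chr G y a b) by exact: chr_smooth.
have BD a b c : chr G y (a + b) c = chr G y a c + chr G y b c.
  by rewrite -[a]scale1r Bl !scale1r.
have E : der v (fun z => chr G z (u + u') w) y =
    der v (fun z => chr G z u w) y + der v (fun z => chr G z u' w) y.
  rewrite -(derD v (Cc u w) (Cc u' w) Oy); apply: (der_eq oO) => // z Oz.
  by have [Bl' _] := chr_bilin oO CG symG posG Oz; rewrite -[u]scale1r Bl' !scale1r.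
have := der_lin 1 u u' (Cc v w) Oy; rewrite !scale1r => ->.
rewrite E !BD (chrDr oO CG symG posG)//.
by apply/rowP => l; rewrite !(mxDE, mxNE); ring.
Qed.

Section Kahler.
Variable K : 'rV[R]_d -> 'M[R]_d.
Hypotheses (CK : smooth_on O K) (KK : forall y, O y -> K y *m K y = - 1%:M)
  (Kiso : forall y u v, O y -> ip (G y) (u *m K y) (v *m K y) = ip (G y) u v)
  (Kpar : forall y u v, O y ->
    der u (fun z => v *m K z) y + chr G y u (v *m K y) - chr G y u v *m K y = 0).

Lemma cov_cplx n (U : set 'rV[R]_n) (F xi : 'rV[R]_n -> 'rV[R]_d)
    (u x : 'rV[R]_n) :
  open U -> smooth_on U F -> (forall x, U x -> O (F x)) -> smooth_on U xi -> U x ->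
  cov G F u (fun y => xi y *m K (F y)) x = cov G F u xi x *m K (F x).
Proof.
move=> oU CF UO Cx Ux; have Oy := UO x Ux.
have CKF : smooth_on U (fun y => K (F y)) by exact: (smooth_comp oU oO UO CF CK).
rewrite !covE (der_mulmx u Cx CKF Ux) (der_comp u UO CF CK Ux).
have := Kpar (der u F x) (xi x) Oy.
rewrite (der_mulmx _ (smooth_cst O (xi x)) CK Oy) der_cst mul0mx add0r.
move=> /eqP; rewrite subr_eq0 => /eqP E.
by rewrite mulmxDl -E addrA.
Qed.

Lemma curvature_cplx y u v w : O y ->
  curvature G y u v (w *m K y) = curvature G y u v w *m K y.
Proof.
move=> Oy; have Cc a : smooth_on O (fun _ : 'rV[R]_d => a : 'rV[R]_d) by exact: smooth_cst.
have := cov_curvature oO CG symG posG oO Cid idO u v (smooth_mulmx oO (Cc w) CK) Oy.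
rewrite !der_id => <-; rewrite curvature_cov//.
have Cv a b : smooth_on O (cov G (fun z => z) a (fun _ => b)).
  exact: (smooth_cov oO CG symG posG oO Cid idO).
have E a b : cov G (fun z => z) a (cov G (fun z => z) b (fun t => w *m K t)) y =
    cov G (fun z => z) a (cov G (fun z => z) b (fun _ => w)) y *m K y.
  rewrite -(cov_cplx a oO Cid idO (Cv b w) Oy) [LHS]covE [RHS]covE.
  have F t : O t -> cov G (fun z => z) b (fun t => w *m K t) t =
     cov G (fun z => z) b (fun _ => w) t *m K t.
    by move=> Ot; exact: (cov_cplx b oO Cid idO (Cc w) Ot).
  by rewrite (der_eq oO a F Oy) F.
by rewrite !E mulmxBl.
Qed.

Lemma ip_cplx_skew y u v : O y -> ip (G y) (u *m K y) v = - ip (G y) u (v *m K y).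
Proof.
move=> Oy; rewrite -(Kiso _ (v *m K y) Oy) -mulmxA KK//.
by rewrite mulmxN mulmx1 ipNr opprK.
Qed.

Lemma const_hol_curvature c y u v w : O y ->
  (forall a, ip (G y) (curvature G y a (a *m K y) (a *m K y)) a = c * ip (G y) a a ^+ 2) ->
  curvature G y u v w = (c / 4) *: (ip (G y) v w *: u - ip (G y) u w *: v
    + ip (G y) (v *m K y) w *: (u *m K y) - ip (G y) (u *m K y) w *: (v *m K y)
    + (2 * ip (G y) u (v *m K y)) *: (w *m K y)).
Proof.
move=> Oy Hhol; apply: (ip_inj (metric_unit posG Oy)) => z.
rewrite (@const_hol_tensor R _ (fun a => a *m K y) (ip (G y)) (curvature G y) c).
- by rewrite ipZl !(ipDl, ipNl, ipZl).
- by move=> a b; exact: mulmxDl.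
- by move=> a; rewrite -mulmxA KK// mulmxN mulmx1.
- by move=> a b; apply: ipC; exact: symG.
- by move=> a b e; exact: ipDl.
- by move=> a b; exact: Kiso.
- by move=> *; exact: curvatureDl.
- by move=> *; rewrite curvatureC.
- by move=> *; exact: curvature_skew.
- by move=> *; exact: curvature_bianchi.
- by move=> *; exact: curvature_cplx.
- exact: Hhol.
Qed.

End Kahler.
End CurvatureTensor.

(** Gram-Schmidt in block form: one elimination step splits off the first coordinate and the
    induction runs on the Schur complement. *)
Lemma orthonormal_basis (R : rcfType) n (g : 'M[R]_n) : g^T = g ->
  (forall u : 'rV[R]_n, u != 0 -> 0 < (u *m g *m u^T) 0 0) ->
  exists P : 'M[R]_n, P *m g *m P^T = 1%:M.
Proof.
elim: n g => [|n IH] g gT gpos; first by exists 1%:M; rewrite !flatmx0; exact: flatmx0.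
move: (g : 'M[R]_(1 + n)) gT gpos => {}g gT gpos.
have {}gpos (u : 'rV[R]_(1 + n)) : u != 0 -> 0 < (u *m g *m u^T) 0 0 := gpos u.
pose a := ulsubmx g; pose b := ursubmx g; pose d := drsubmx g.
have Eg : g = block_mx a b b^T d.
  by rewrite -[LHS]submxK /b trmx_ursub gT.
have Ea : a = (a 0 0)%:M by rewrite [LHS]mx11_scalar.
have a0 : 0 < a 0 0.
  have := gpos (row_mx 1 0); rewrite Eg mul_row_block tr_row_mx mul_row_col.
  rewrite !mul0mx !trmx0 !mulmx0 !addr0 !mul1mx trmx1 mulmx1; apply.
  apply/eqP => /(congr1 lsubmx); rewrite row_mxKl => /matrixP/(_ 0 0).
  by rewrite !mxE => /eqP; rewrite oner_eq0.
have aN0 : a 0 0 != 0 by rewrite gt_eqF.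
(* [l] is chosen so that [l *m a + b^T = 0]; congruence by [L] then leaves the diagonal blocks [a]
   and [S], and [S] inherits positivity through the vectors [row_mx 0 v *m L]. *)
pose l : 'M[R]_(n, 1) := - (a 0 0)^-1 *: b^T.
have la : l *m a = - b^T by rewrite Ea /l -scalemxAl mul_mx_scalar scaleNr scalerA mulVf ?scale1r.
pose S := l *m b + d.
pose L : 'M[R]_(1 + n) := block_mx 1 0 l 1.
have aT : a^T = a by rewrite Ea tr_scalar_mx.
have EL : L *m g *m L^T = block_mx a 0 0 S.
  rewrite Eg /L mulmx_block tr_block_mx mulmx_block !mul1mx !mul0mx !addr0 !trmx0 !trmx1.
  rewrite !mulmx1 !mulmx0 !addr0 la addNr !mul0mx add0r.
  have -> : a *m l^T + b = 0 by rewrite -{1}aT -trmx_mul la linearN /= trmxK addNr.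
  by rewrite -/S.
have ST : S^T = S.
  have : (L *m g *m L^T)^T = L *m g *m L^T by rewrite !trmx_mul trmxK gT mulmxA.
  by rewrite EL tr_block_mx => /eq_block_mx[].
have Spos (v : 'rV[R]_n) : v != 0 -> 0 < (v *m S *m v^T) 0 0.
  move=> v0; have LN0 : row_mx 0 v *m L != 0.
    rewrite /L mul_row_block; apply/eqP => /(congr1 rsubmx).
    by rewrite row_mxKr !(mul0mx, mulmx1, add0r, linear0) => /eqP; exact/negP.
  have E : row_mx 0 v *m block_mx a 0 0 S = row_mx 0 (v *m S).
    by rewrite mul_row_block !(mul0mx, mulmx0, add0r, addr0).
  have := gpos _ LN0; rewrite trmx_mul !mulmxA -2!(mulmxA (row_mx 0 v)) EL E.
  by rewrite tr_row_mx mul_row_col mul0mx add0r.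
have [P PS] := IH S ST Spos.
pose q : 'M[R]_1 := (Num.sqrt (a 0 0))^-1%:M; pose Q : 'M[R]_(1 + n) := block_mx q 0 0 P.
have Eq : q *m a *m q^T = 1%:M.
  rewrite Ea tr_scalar_mx -!scalar_mxM mulrAC -expr2 exprVn sqr_sqrtr ?ltW//.
  by rewrite mulVf.
exists (Q *m L).
have -> : Q *m L *m g *m (Q *m L)^T = Q *m (L *m g *m L^T) *m Q^T.
  by rewrite trmx_mul !mulmxA.
rewrite EL /Q tr_block_mx !trmx0 !mulmx_block !(mulmx0, mul0mx, addr0, add0r) PS Eq.
by rewrite -scalar_mx_block.
Qed.

(** * Consequences of the Ricci equation at a point *)

(* [X u] is the tangent vector dF(u), [B] the second fundamental form, [A r] the
   shape operator of [K (X r)] and [p] an orthonormal frame. *)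
Section PointwiseAlgebra.
Context (R : realFieldType) (n : nat) (W E : lmodType R).
Variables (ip : W -> W -> R) (K : W -> W) (X : E -> W) (B : E -> E -> W)
  (A : E -> E -> E) (p : 'I_n -> E) (zeta : W) (k : R).
Hypotheses
  (ipC : forall a b, ip a b = ip b a)
  (ipD : forall a b e, ip (a + b) e = ip a e + ip b e)
  (ipZ : forall t a e, ip (t *: a) e = t * ip a e)
  (ip_gt0 : forall a, a != 0 -> 0 < ip a a)
  (Kiso : forall a b, ip (K a) (K b) = ip a b)
  (Kskew : forall a b, ip (K a) b = - ip a (K b))
  (XD : forall u v, X (u + v) = X u + X v) (XZ : forall t u, X (t *: u) = t *: X u)
  (XK : forall u v, ip (K (X u)) (X v) = 0).
Let g u v := ip (X u) (X v).
Let C u v w := ip (B u v) (K (X w)).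
Hypotheses
  (p_span : forall u, u = \sum_i g u (p i) *: p i)
  (p_orth : forall i j, g (p i) (p j) = (i == j)%:R)
  (BC : forall u v, B u v = B v u)
  (BD : forall u u' v, B (u + u') v = B u v + B u' v)
  (BZ : forall t u v, B (t *: u) v = t *: B u v)
  (BX : forall u v w, ip (B u v) (X w) = 0)
  (CC : forall u v w, C u v w = C u w v)
  (AE : forall u v w, g (A u v) w = C u v w)
  (ricci : forall r s w, k *: (g r w *: K (X s) - g s w *: K (X r)) =
     B r (A s w) - B s (A r w))
  (zetaE : n%:R *: zeta = \sum_i B (p i) (p i))
  (umb : forall u v, ip (B u v) zeta = ip zeta zeta * g u v)
  (n2 : (2 <= n)%N) (k0 : k != 0).

Let ip0 e : ip 0 e = 0.
Proof. by rewrite -(scale0r 0) ipZ mul0r. Qed.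

Let ipN a e : ip (- a) e = - ip a e.
Proof. by rewrite -scaleN1r ipZ mulN1r. Qed.

Let ip_sum (I : Type) (r : seq I) (P : pred I) (f : I -> W) e :
  ip (\sum_(i <- r | P i) f i) e = \sum_(i <- r | P i) ip (f i) e.
Proof. exact: (big_morph (ip ^~ e) (fun a b => ipD a b e) (ip0 e)). Qed.

Let ip_eq0 a : ip a a = 0 -> a = 0.
Proof. by move=> h; apply/eqP/negP => /negP/ip_gt0; rewrite h ltxx. Qed.

Let gC u v : g u v = g v u.
Proof. exact: ipC. Qed.

Let gD u v w : g (u + v) w = g u w + g v w.
Proof. by rewrite /g XD ipD. Qed.

Let gZ t u w : g (t *: u) w = t * g u w.
Proof. by rewrite /g XZ ipZ. Qed.

Let g_inj u v : (forall w, g u w = g v w) -> u = v.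
Proof. by move=> h; rewrite (p_span u) (p_span v); apply: eq_bigr => i _; rewrite h. Qed.

Let AC u v : A u v = A v u.
Proof. by apply: g_inj => w; rewrite !AE /C BC. Qed.

Let lin_p (f : E -> R) u : (forall a b, f (a + b) = f a + f b) ->
  (forall t a, f (t *: a) = t * f a) -> \sum_i g u (p i) * f (p i) = f u.
Proof.
move=> fD fZ; have f0 : f 0 = 0 by rewrite -(scale0r 0) fZ mul0r.
rewrite [in RHS](p_span u) (big_morph f fD f0).
by apply: eq_bigr => i _; rewrite fZ.
Qed.

Let sum_gpp : \sum_i g (p i) (p i) = n%:R.
Proof.
under eq_bigr do rewrite p_orth eqxx.
by rewrite sumr_const card_ord.
Qed.

Let ricci_ip e r s w : k * (g r w * ip (K (X s)) e - g s w * ip (K (X r)) e) =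
  ip (B r (A s w)) e - ip (B s (A r w)) e.
Proof.
by have /(congr1 (ip ^~ e)) /= := ricci r s w; rewrite ipZ !ipD !ipN !ipZ.
Qed.

(** Paired with [zeta], the right side of [ricci] becomes |zeta|^2 (<r, A_s w> - <s, A_r w>), which
    vanishes by the symmetry of [C]. Setting [r = w = p i] and summing leaves (n - 1) <zeta, K (X
    s)> = 0. *)
Lemma mean_curvature_perp s : ip zeta (K (X s)) = 0.
Proof.
have E0 r w : k * (g r w * ip (K (X s)) zeta - g s w * ip (K (X r)) zeta) = 0.
  rewrite ricci_ip !umb (gC r) (gC s) !AE (CC s w r) (CC r w s) /C (BC s r); ring.
have E1 i : g (p i) (p i) * ip (K (X s)) zeta - g s (p i) * ip (K (X (p i))) zeta = 0.
  by apply/eqP; have /eqP := E0 (p i) (p i); rewrite mulf_eq0 (negbTE k0).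
have : \sum_i (g (p i) (p i) * ip (K (X s)) zeta - g s (p i) * ip (K (X (p i))) zeta) = 0.
  by rewrite big1.
rewrite sumrB -mulr_suml sum_gpp (lin_p (f := fun u => ip (K (X u)) zeta)).
- rewrite -[X in _ - X]mul1r -mulrBl.
  move=> /eqP; rewrite mulf_eq0 ipC => /orP[|/eqP//].
  by rewrite subr_eq0 pnatr_eq1 => /eqP n1; have := n2; rewrite [X in (_ <= X)%N]n1.
- by move=> a b; rewrite !Kskew XD ipD opprD.
- by move=> t a; rewrite !Kskew XZ ipZ mulrN.
Qed.

Lemma ricci_bracket r s w : A r (A s w) - A s (A r w) = k *: (g r w *: s - g s w *: r).
Proof.
apply: g_inj => v; rewrite -[- A s _]scaleN1r -[- (g s w *: r)]scaleN1r.
rewrite !(gD, gZ) !AE.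
by have := ricci_ip (K (X v)) r s w; rewrite !Kiso -!/(g _ _) -!/(C _ _ _) !mulN1r => ->.
Qed.

(** Paired with [eta], the left side of [ricci] vanishes, so the shape operator of [eta] commutes
    with every [A r] ([bA]), hence with their brackets. These are k times the infinitesimal
    rotations of the planes of [r] and [s], which is [E0]; contracting [E0] over [r = w = p i] shows
    that [b] is the metric times its normalised trace, that is <zeta, eta>. *)
Lemma normal_umbilic eta u v : (forall w, ip eta (X w) = 0) ->
  (forall w, ip eta (K (X w)) = 0) -> ip (B u v) eta = ip zeta eta * g u v.
Proof.
move=> eX eK; pose b u v := ip (B u v) eta.
have bC a e : b a e = b e a by rewrite /b BC.
have bD a a' e : b (a + a') e = b a e + b a' e by rewrite /b BD ipD.
have bZ t a e : b (t *: a) e = t * b a e by rewrite /b BZ ipZ.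
have bA r y w : b (A r y) w = b y (A r w).
  have := ricci_ip eta w y r; rewrite [ip (K (X y)) _]ipC [ip (K (X w)) _]ipC !eK.
  by rewrite -!/(b _ _) (AC y) (AC w) (bC w) => E0; lra.
have E0 r s w z : g r w * b s z - g s w * b r z + g r z * b s w - g s z * b r w = 0.
  have F a e : k * (g r a * b s e - g s a * b r e) = b (A s a) (A r e) - b (A r a) (A s e).
    have /(congr1 (b ^~ e)) /= := ricci_bracket r s a.
    rewrite -[- A s _]scaleN1r -[- (g s a *: r)]scaleN1r !(bD, bZ) !bA => E1; lra.
  have := F w z; have := F z w; rewrite (bC (A s z)) (bC (A r z)) => F1 F2.
  have : k * (g r w * b s z - g s w * b r z + g r z * b s w - g s z * b r w) = 0 by lra.
  by move=> /eqP; rewrite mulf_eq0 (negbTE k0) => /eqP.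
have : \sum_i (g (p i) (p i) * b u v - g u (p i) * b (p i) v + g v (p i) * b (p i) u
     - g u v * b (p i) (p i)) = 0.
  by rewrite big1// => i _; have := E0 (p i) u (p i) v; rewrite (gC (p i) v) (bC u (p i)).
rewrite sumrB big_split sumrB /= -mulr_suml sum_gpp -mulr_sumr.
rewrite (lin_p (f := b ^~ v))// (lin_p (f := b ^~ u))// (bC v u).
have -> : \sum_i b (p i) (p i) = n%:R * ip zeta eta by rewrite -ip_sum -zetaE ipZ.
move=> E1; have n0 : n%:R != 0 :> R by rewrite pnatr_eq0 -lt0n (leq_trans _ n2).
apply: (mulfI n0); rewrite -/(b u v); lra.
Qed.

(** The defect [D] is orthogonal to the tangent space and to its image under [K], so
    [normal_umbilic] applies with [eta = D]. It gives <B(u, v), D> = <u, v> <zeta, D>, whence <D, D>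
    = 0. *)
Lemma second_form_decomposition u v : B u v = K (X (A u v)) + g u v *: zeta.
Proof.
have zX w : ip zeta (X w) = 0.
  have n0 : n%:R != 0 :> R by rewrite pnatr_eq0 -lt0n (leq_trans _ n2).
  apply: (mulfI n0); rewrite -ipZ zetaE ip_sum mulr0 big1// => i _; exact: BX.
pose D := B u v + - (K (X (A u v)) + g u v *: zeta).
have DX w : ip D (X w) = 0 by rewrite /D ipD ipN ipD ipZ BX XK zX mulr0; ring.
have DK w : ip D (K (X w)) = 0.
  by rewrite /D ipD ipN ipD ipZ Kiso mean_curvature_perp -/(g _ w) AE -/(C u v w); ring.
have DD : ip D D = 0.
  rewrite {1}/D ipD ipN ipD ipZ (normal_umbilic u v DX DK) [ip (K _) D]ipC DK; ring.
by apply/eqP; rewrite -subr_eq0 -/D; apply/eqP; exact: ip_eq0.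
Qed.

Lemma shape_traceless w : \sum_i g (A w (p i)) (p i) = 0.
Proof.
have E0 i : g (A w (p i)) (p i) = ip (B (p i) (p i)) (K (X w)).
  by rewrite AC AE CC.
under eq_bigr do rewrite E0.
by rewrite -ip_sum -zetaE ipZ mean_curvature_perp mulr0.
Qed.

End PointwiseAlgebra.

(** * Matrix traces and their derivatives *)

Lemma mulmx_ext (R : pzRingType) m n (M M' : 'M[R]_(m, n)) :
  (forall u : 'rV_m, u *m M = u *m M') -> M = M'.
Proof. by move=> E; apply/row_matrixP => i; rewrite !rowE. Qed.

Lemma mxtrace_mul_row (R : comPzRingType) n (M : 'M[R]_n) (u v : 'rV[R]_n) :
  \tr (M *m u^T *m v) = (v *m M *m u^T) 0 0.
Proof. by rewrite mxtrace_mulC mulmxA /mxtrace big_ord1. Qed.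

Lemma ip_row (R : realType) m n p (g : 'M[R]_n) (P : 'M[R]_(m, n)) (Q : 'M[R]_(p, n)) i j :
  ip g (row i P) (row j Q) = (P *m g *m Q^T) i j.
Proof.
rewrite ipE -!row_mul !mxE; apply: eq_bigr => l _.
by rewrite !mxE.
Qed.

Lemma mxtrace_orthonormal (R : realType) n (g P M : 'M[R]_n) : P *m g *m P^T = 1%:M ->
  \tr M = \sum_i ip g (row i P *m M) (row i P).
Proof.
move=> PgP; have gPP : g *m P^T *m P = 1%:M by apply: mulmx1C; rewrite mulmxA.
rewrite -[M in LHS]mulmx1 -gPP mulmxA mxtrace_mulC !mulmxA /mxtrace.
by apply: eq_bigr => i _; rewrite -row_mul ip_row.
Qed.

Lemma der_mxtrace (R : realType) (V : normedModType R) (U : set V) n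
    (M : V -> 'M[R]_n) v x : smooth_on U M -> U x ->
  der v (fun y => \tr (M y)) x = \tr (der v M x).
Proof.
move=> CM Ux; have dM := smooth_differentiable CM Ux.
rewrite derE /mxtrace derive_bigsum; last by move=> i; move/differentiable_mx : dM.
by apply: eq_bigr => i _; rewrite derE -derive_entry.
Qed.

Lemma der_sum (R : realType) (V W : normedModType R) (U : set V) n (f : 'I_n -> V -> W) v x :
  (forall i, smooth_on U (f i)) -> U x ->
  der v (fun y => \sum_(i < n) f i y) x = \sum_(i < n) der v (f i) x.
Proof.
move=> Cf Ux; rewrite derE derive_bigsum => [|i]; last exact: smooth_differentiable Ux.
by apply: eq_bigr => i _; rewrite derE.
Qed.

Lemma derB (R : realType) (V : normedModType R) (U : set V) m n
    (f g : V -> 'M[R]_(m, n)) v x :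
  open U -> smooth_on U f -> smooth_on U g -> U x ->
  der v (fun y => f y - g y) x = der v f x - der v g x.
Proof.
move=> oU Cf Cg Ux; rewrite (derD v Cf (smoothN oU Cg) Ux); congr (_ + _).
have Cc := smooth_cst U (-1 : R).
rewrite (der_eq (g := fun y => -1 *: g y) oU v _ Ux).
  by rewrite (der_scalemx v Cc Cg Ux) der_cst scale0r add0r scaleN1r.
by move=> y _; rewrite scaleN1r.
Qed.

Ltac mx_expand := rewrite ?(mulmxDl, mulmxDr, mulmxBl, mulmxBr, mulNmx, mulmxN, mulmxA).
Ltac mx_ring := mx_expand; apply/matrixP; let i := fresh in let j := fresh in
  intros i j; rewrite ?(mxDE, mxNE); ring.

(** * The Simons-type identity *)

(* In coordinates: [g] is the metric of M, [A r] the shape operator of [J X_r], [N s]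
   the Christoffel endomorphism [u |-> nabla_s u], and [h = |zeta|^2]. *)
Section Simons.
Context (R : realType) (n : nat) (U : set 'rV[R]_n).
Variables (g : 'rV[R]_n -> 'M[R]_n) (A N : 'rV[R]_n -> 'rV[R]_n -> 'M[R]_n)
  (k : R) (h : 'rV[R]_n -> R).
Implicit Types r s u v w x : 'rV[R]_n.
Hypotheses (oU : open U) (Cg : smooth_on U g)
  (CA : forall r, smooth_on U (A r)) (CN : forall r, smooth_on U (N r))
  (gT : forall x, U x -> (g x)^T = g x)
  (Alin : forall x c r s, U x -> A (c *: r + s) x = c *: A r x + A s x)
  (AC : forall x u v, U x -> u *m A v x = v *m A u x)
  (NC : forall x u v, U x -> u *m N v x = v *m N u x)
  (Ag : forall x r, U x -> A r x *m g x = g x *m (A r x)^T)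
  (dg : forall x s, U x -> der s g x = N s x *m g x + g x *m (N s x)^T)
  (bracket : forall x r s w, U x -> w *m (A s x *m A r x - A r x *m A s x) =
     k *: (ip (g x) r w *: s - ip (g x) s w *: r))
  (trA : forall x r, U x -> \tr (A r x) = 0)
  (codazzi : forall x s r, U x ->
     der s (A r) x + A r x *m N s x + N r x *m A s x =
     der r (A s) x + A s x *m N r x + N s x *m A r x)
  (gauss : forall x s r u, U x ->
     u *m (der s (N r) x - der r (N s) x + N r x *m N s x - N s x *m N r x) =
     h x *: (ip (g x) r u *: s - ip (g x) s u *: r)).

Let AD x r s : U x -> A (r + s) x = A r x + A s x.
Proof. by move=> Ux; rewrite -[r]scale1r Alin// !scale1r. Qed.

Let A0 x : U x -> A 0 x = 0.
Proof.
by move=> Ux; have /eqP := AD 0 0 Ux; rewrite addr0 -subr_eq0 opprD addNKr oppr_eq0 => /eqP.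
Qed.

Let AN x r : U x -> A (- r) x = - A r x.
Proof. by move=> Ux; rewrite -[- r]addr0 -scaleN1r Alin// A0// addr0 scaleN1r. Qed.

(** The covariant derivative (nabla_s A)_r. With maps acting on the right, [A r x *m N s x]
    differentiates the value, [N s x *m A r x] the argument, and the last term accounts for the
    label [r], whose components are constant. *)
Definition nablaA s r x : 'M[R]_n :=
  der s (A r) x + A r x *m N s x - N s x *m A r x - A (r *m N s x) x.
Local Notation E := nablaA.

Let derA s r x : der s (A r) x =
  E s r x - A r x *m N s x + N s x *m A r x + A (r *m N s x) x.
Proof. by rewrite /E; mx_ring. Qed.

Let EC s r x : U x -> E s r x = E r s x.
Proof.
move=> Ux; rewrite /E (NC r s Ux).
have := codazzi s r Ux => E0.
have -> : der s (A r) x = der r (A s) x + A s x *m N r x + N s x *m A r x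
   - A r x *m N s x - N r x *m A s x by rewrite -E0; mx_ring.
by mx_ring.
Qed.

(** The relation A_r u = A_u r is differentiated. With [EC] and the self-adjointness [Eg] it makes
    <(nabla_s A)_r u, w> totally symmetric in its four arguments. *)
Let E_swap s r u x : U x -> u *m E s r x = r *m E s u x.
Proof.
move=> Ux; rewrite /E.
have D a b : a *m der s (A b) x = der s (fun y => a *m A b y) x.
  by rewrite (der_mulmx s (smooth_cst U a) (CA b) Ux) der_cst mul0mx add0r.
have E1 : u *m der s (A r) x = r *m der s (A u) x.
  by rewrite !D; apply: (der_eq oU) => // y Uy; exact: AC.
rewrite !(mulmxBr, mulmxDr) E1 !mulmxA (AC u r Ux) (AC (u *m N s x) r Ux).
by rewrite (AC u (r *m N s x) Ux) addrAC.
Qed.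

Let trE s r x : U x -> \tr (E s r x) = 0.
Proof.
move=> Ux; rewrite /E !raddfB /= mxtraceD [\tr (A r x *m _)]mxtrace_mulC trA// -(der_mxtrace s (CA r) Ux).
rewrite (der_eq (g := fun=> 0) oU s _ Ux) ?der_cst; last by move=> y Uy; exact: trA.
by rewrite add0r subr0 subrr.
Qed.

Let bracketM x r s : U x -> A s x *m A r x - A r x *m A s x =
  k *: (g x *m r^T *m s - g x *m s^T *m r).
Proof.
move=> Ux; apply: mulmx_ext => w; rewrite bracket// -scalemxAr mulmxBr !mulmxA.
rewrite [w *m g x *m r^T]mx11_scalar [w *m g x *m s^T]mx11_scalar !mul_scalar_mx.
by rewrite -!ipE !(ipC w _ (gT Ux)).
Qed.

(** Since A_s u = A_u s, the bracket relation for [v], [s] applied to [u] is an identity between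
    endomorphisms evaluated at [s] ([E0]). Its trace in [s] gives n - 1: n from the identity and -1
    from the rank-one term, while the trace of A at the vector A_v u vanishes. *)
Let trAA x u v : U x -> \tr (A u x *m A v x) = k * (n%:R - 1) * ip (g x) u v.
Proof.
move=> Ux.
have E0 : A u x *m A v x - A (u *m A v x) x =
    k *: (ip (g x) v u *: 1%:M - g x *m u^T *m v).
  apply: mulmx_ext => s; rewrite mulmxBr mulmxA (AC s u Ux) (AC s _ Ux).
  have := bracket v s u Ux; rewrite mulmxBr !mulmxA => ->.
  rewrite -scalemxAr mulmxBr -scalemxAr mulmx1 !mulmxA.
  by rewrite [s *m g x *m u^T]mx11_scalar mul_scalar_mx -ipE.
have /(congr1 (fun M => \tr M)) := E0.
rewrite mxtraceZ !raddfB /= (trA (u *m A v x) Ux) subr0 mxtraceZ mxtrace1.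
rewrite mxtrace_mul_row -ipE (ipC v u (gT Ux)) => ->; ring.
Qed.

Let ipNl_g x r u v : U x -> ip (N r x *m g x + g x *m (N r x)^T) u v =
  ip (g x) (u *m N r x) v + ip (g x) u (v *m N r x).
Proof. by move=> Ux; rewrite ipDG !ipE trmx_mul !mulmxA. Qed.

(** Differentiates [trAA]. The metric being parallel, the derivative of the right side consists of
    connection terms only, which [trAA] turns back into traces matching those of the left side. *)
Let trEA_skew r u v x : U x -> \tr (E r u x *m A v x) = - \tr (E r v x *m A u x).
Proof.
move=> Ux.
have D1 : der r (fun y => \tr (A u y *m A v y)) x =
    \tr (der r (A u) x *m A v x) + \tr (A u x *m der r (A v) x).
  rewrite (der_mxtrace r (smooth_mulmx oU (CA u) (CA v)) Ux).
  by rewrite (der_mulmx r (CA u) (CA v) Ux) mxtraceD.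
have D2 : der r (fun y => \tr (A u y *m A v y)) x = \tr (A (u *m N r x) x *m A v x)
    + \tr (A u x *m A (v *m N r x) x).
  have E0 y : U y -> \tr (A u y *m A v y) =
      \tr ((k * (n%:R - 1)) *: (u *m g y *m v^T)).
    by move=> Uy; rewrite trAA// mxtraceZ ipE /mxtrace big_ord1.
  have Cug : smooth_on U (fun y => u *m g y).
    exact: (smooth_mulmx oU (smooth_cst U u) Cg).
  have Cugv : smooth_on U (fun y => u *m g y *m v^T).
    exact: (smooth_mulmx oU Cug (smooth_cst U v^T)).
  rewrite (der_eq oU r E0 Ux).
  rewrite (der_mxtrace r (smoothZ oU (smooth_cst U (k * (n%:R - 1))) Cugv) Ux).
  rewrite (der_scalemx r (smooth_cst U (k * (n%:R - 1))) Cugv Ux) der_cst scale0r add0r.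
  rewrite (der_mulmx r Cug (smooth_cst U v^T) Ux) der_cst mulmx0 addr0.
  rewrite (der_mulmx r (smooth_cst U u) Cg Ux) der_cst mul0mx add0r.
  rewrite mxtraceZ [\tr (u *m _ *m _)]/mxtrace big_ord1 -ipE dg// ipNl_g//.
  by rewrite mulrDr -!trAA.
move: D2; rewrite {}D1 !derA; move: (E r u x) (E r v x) => eu ev; mx_expand.
rewrite !(mxtraceD, raddfN) /= [\tr (A u x *m ev)]mxtrace_mulC.
rewrite -[N r x *m A u x *m A v x]mulmxA [\tr (N r x *m _)]mxtrace_mulC.
lra.
Qed.

(* tr (nabla_r A_u A_v) is symmetric in [r, u] and skew in [u, v]. *)
Let trEA r u v x : U x -> \tr (E r u x *m A v x) = 0.
Proof.
move=> Ux.
have := trEA_skew r u v Ux; have := trEA_skew v r u Ux; have := trEA_skew u v r Ux.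
rewrite (EC v r Ux) (EC u v Ux) (EC u r Ux) => H1 H2 H3.
have := trEA_skew r v u Ux; have := trEA_skew u r v Ux; have := trEA_skew v u r Ux.
by rewrite (EC u r Ux) (EC v u Ux); lra.
Qed.

(** Leibniz rule for a label moving with the point, as in the term [A (r *m N s x) x] of
    [nablaA]. *)
Let derAz z s x : smooth_on U z -> U x ->
  der s (fun y => A (z y) y) x = der s (A (z x)) x + A (der s z x) x.
Proof.
move=> Cz Ux.
have Az y w : U y -> A w y = \sum_(i < n) w 0 i *: A (delta_mx 0 i) y.
  by move=> Uy; exact: (@lin_row_sum R n _ (fun w => A w y) w (fun c a b => Alin c a b Uy)).
have Czi i : smooth_on U (fun y => z y 0 i) by exact: ((smooth_mx oU z).1 Cz 0 i).
have CzA i : smooth_on U (fun y => z y 0 i *: A (delta_mx 0 i) y).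
  exact: (smoothZ oU (Czi i) (CA _)).
rewrite (der_eq oU s (fun y Uy => Az y (z y) Uy) Ux).
rewrite (der_eq oU s (fun y Uy => Az y (z x) Uy) Ux) (Az x (der s z x) Ux).
rewrite !(der_sum s _ Ux); [|by move=> i; exact: (smoothZ oU (smooth_cst U _) (CA _))|done].
rewrite -big_split; apply: eq_bigr => i _.
rewrite (der_scalemx s (Czi i) (CA _) Ux).
rewrite (der_scalemx s (smooth_cst U (z x 0 i)) (CA _) Ux) der_cst scale0r add0r addrC.
by congr (_ + _ *: _); rewrite !derE derive_entry//; exact: smooth_differentiable Ux.
Qed.

Let smooth_Az z : smooth_on U z -> smooth_on U (fun y => A (z y) y).
Proof.
move=> Cz; have Az y : U y -> \sum_(i < n) z y 0 i *: A (delta_mx 0 i) y = A (z y) y.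
  move=> Uy; exact/esym/(@lin_row_sum R n _ (fun w => A w y) _ (fun c a b => Alin c a b Uy)).
apply: (smooth_eq oU Az); apply: (smooth_sum oU) => i _.
exact: (smoothZ oU ((smooth_mx oU z).1 Cz 0 i) (CA _)).
Qed.

(** The Ricci identity for A: the curvature [Om] acts on values, arguments and the label. Because
    [der] is the coordinate derivative, first-order connection terms remain. *)
Let derE_diff s r u x : U x ->
  let Om := der s (N r) x - der r (N s) x + N r x *m N s x - N s x *m N r x in
  der s (E r u) x - der r (E s u) x =
  A u x *m Om - Om *m A u x - A (u *m Om) x + (E s u x *m N r x - N r x *m E s u x)
  - (E r u x *m N s x - N s x *m E r u x) - E s (u *m N r x) x + E r (u *m N s x) x.
Proof.
move=> Ux Om.
have F a b : der a (E b u) x = der a (der b (A u)) x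
    + (der a (A u) x *m N b x + A u x *m der a (N b) x)
    - (der a (N b) x *m A u x + N b x *m der a (A u) x)
    - (der a (A (u *m N b x)) x + A (u *m der a (N b) x) x).
  have CuN : smooth_on U (fun y => u *m N b y).
    exact: (smooth_mulmx oU (smooth_cst U u) (CN b)).
  have CAN := smooth_mulmx oU (CA u) (CN b); have CNA := smooth_mulmx oU (CN b) (CA u).
  have CAz := smooth_Az CuN.
  have CD := smooth_der b (CA u).
  rewrite /nablaA (derB a oU (smoothB oU (smoothD oU CD CAN) CNA) CAz Ux).
  rewrite (derB a oU (smoothD oU CD CAN) CNA Ux) (derD a CD CAN Ux).
  rewrite (der_mulmx a (CA u) (CN b) Ux) (der_mulmx a (CN b) (CA u) Ux) (derAz a CuN Ux).
  by rewrite (der_mulmx a (smooth_cst U u) (CN b) Ux) der_cst mul0mx add0r.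
have AOm : A (u *m Om) x = A (u *m der s (N r) x) x - A (u *m der r (N s) x) x
    + A (u *m N r x *m N s x) x - A (u *m N s x *m N r x) x.
  by rewrite /Om !(mulmxBr, mulmxDr) !AD// !AN// !mulmxA.
rewrite !F AOm (der_comm oU r s (CA u) Ux) /Om.
rewrite (derA s u) (derA r u) (derA s (u *m N r x)) (derA r (u *m N s x)).
move: (E s u x) (E r u x) (E s (u *m N r x) x) (E r (u *m N s x) x) => e1 e2 e3 e4.
by mx_ring.
Qed.

(* The curvature terms come from commuting derivatives in tr (nabla_r A_u A_v) = 0. *)
Lemma simons_identity s r u v x : U x ->
  \tr (E r u x *m E s v x) - \tr (E s u x *m E r v x) =
  k * (n%:R + 1) * (h x * (ip (g x) r u * ip (g x) s v - ip (g x) s u * ip (g x) r v)).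
Proof.
move=> Ux.
pose Om := der s (N r) x - der r (N s) x + N r x *m N s x - N s x *m N r x.
have CE a b : smooth_on U (E a b).
  have CAz := smooth_Az (smooth_mulmx oU (smooth_cst U b) (CN a)).
  have CD := smooth_der a (CA b).
  have CAN := smooth_mulmx oU (CA b) (CN a); have CNA := smooth_mulmx oU (CN a) (CA b).
  exact: (smoothB oU (smoothB oU (smoothD oU CD CAN) CNA) CAz).
have Z a b : \tr (der a (E b u) x *m A v x) + \tr (E b u x *m der a (A v) x) = 0.
  rewrite -mxtraceD -(der_mulmx a (CE b u) (CA v) Ux).
  rewrite -(der_mxtrace a (smooth_mulmx oU (CE b u) (CA v)) Ux).
  rewrite (der_eq (g := fun=> 0) oU a _ Ux) ?der_cst// => y Uy; exact: trEA.
have Zd : \tr ((der s (E r u) x - der r (E s u) x) *m A v x)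
    + \tr (E r u x *m der s (A v) x) - \tr (E s u x *m der r (A v) x) = 0.
  rewrite mulmxBl raddfB /=; have := Z s r; have := Z r s; lra.
have uOm w : w *m Om = h x *: (ip (g x) r w *: s - ip (g x) s w *: r) by exact: gauss.
have ipOm a b : ip (g x) (a *m Om) b =
    h x * (ip (g x) r a * ip (g x) s b - ip (g x) s a * ip (g x) r b).
  by rewrite uOm ipZl ipBl !ipZl.
(* The action of [Om] on values and arguments contributes the factor 2 k here, its action on the
   label contributes k (n - 1) in [T2]; together they form the constant k (n + 1). *)
have T1 : \tr (A u x *m Om *m A v x) - \tr (Om *m A u x *m A v x) =
    - 2 * k * ip (g x) (u *m Om) v.
  rewrite [\tr (A u x *m Om *m _)]mxtrace_mulC mulmxA [\tr (A v x *m _ *m _)]mxtrace_mulC.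
  rewrite -mulmxA -raddfB /= -mulmxBr (bracketM u v Ux) -scalemxAr mxtraceZ mulmxBr raddfB /=.
  rewrite !mulmxA !mxtrace_mul_row -mulmxA -(mulmxA u) !mulmxA -!ipE !ipOm.
  by ring.
have := Zd; rewrite (derE_diff s r u Ux) -/Om (derA s v) (derA r v).
have T2 := trAA (u *m Om) v Ux.
have T3 := trEA s (u *m N r x) v Ux; have T4 := trEA r (u *m N s x) v Ux.
have T5 := trEA r u (v *m N s x) Ux; have T6 := trEA s u (v *m N r x) Ux.
move: (E s u x) (E r u x) (E s (u *m N r x) x) (E r (u *m N s x) x) (E s v x) (E r v x)
  T3 T4 T5 T6 => e1 e2 e3 e4 e5 e6 T3 T4 T5 T6.
have C1 : \tr (N r x *m e1 *m A v x) = \tr (e1 *m A v x *m N r x).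
  by rewrite -mulmxA mxtrace_mulC.
have C2 : \tr (N s x *m e2 *m A v x) = \tr (e2 *m A v x *m N s x).
  by rewrite -mulmxA mxtrace_mulC.
have := ipOm u v; clear Zd uOm ipOm; clearbody Om => ipOm.
mx_expand; rewrite !(mxtraceD, raddfN, raddfB) /= T3 T4 T5 T6 T2 C1 C2.
move: T1; rewrite ipOm; lra.
Qed.

Let Eg s r x : U x -> E s r x *m g x = g x *m (E s r x)^T.
Proof.
move=> Ux.
have D : der s (A r) x *m g x + A r x *m der s g x =
    der s g x *m (A r x)^T + g x *m (der s (A r) x)^T.
  have CAT := smooth_trmx oU (CA r).
  rewrite -(der_mulmx s (CA r) Cg Ux) -(der_trmx s (CA r) Ux) -(der_mulmx s Cg CAT Ux).
  by apply: (der_eq oU) => // y Uy; exact: Ag.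
have TB (a b : 'M[R]_n) : (a - b)^T = a^T - b^T by exact: raddfB.
have TD (a b : 'M[R]_n) : (a + b)^T = a^T + b^T by exact: raddfD.
rewrite /E !(TB, TD) !trmx_mul !(mulmxBl, mulmxDl, mulmxBr, mulmxDr).
rewrite (Ag (r *m N s x) Ux) -[N s x *m A r x *m g x]mulmxA (Ag r Ux) !mulmxA.
have -> : der s (A r) x *m g x = der s g x *m (A r x)^T + g x *m (der s (A r) x)^T
    - A r x *m der s g x by rewrite -D addrK.
rewrite dg// !(mulmxDl, mulmxDr) !mulmxA -[A r x *m g x *m _]mulmxA.
rewrite (_ : A r x *m (g x *m (N s x)^T) = g x *m (A r x)^T *m (N s x)^T); last first.
  by rewrite mulmxA Ag.
by mx_ring.
Qed.

Let ip_self_adjoint (M : 'M[R]_n) x u v : M *m g x = g x *m M^T ->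
  ip (g x) (u *m M) v = ip (g x) u (v *m M).
Proof. by move=> Mg; rewrite !ipE trmx_mul !mulmxA -(mulmxA u) Mg !mulmxA. Qed.

Lemma simons_bound x (P : 'M[R]_n) : U x -> P *m g x *m P^T = 1%:M ->
  (forall u, 0 <= ip (g x) u u) -> (2 <= n)%N -> k != 0 -> h x <= 0.
Proof.
move=> Ux PgP gpos n2 k0.
pose p i := row i P.
have p_orth i j : ip (g x) (p i) (p j) = (i == j)%:R.
  by rewrite ip_row PgP mxE.
have tr_p M : \tr M = \sum_i ip (g x) (p i *m M) (p i) by exact: mxtrace_orthonormal.
have tr_sq (M : 'M[R]_n) : M *m g x = g x *m M^T -> 0 <= \tr (M *m M).
  move=> Mg; rewrite tr_p; apply: sumr_ge0 => i _.
  by rewrite mulmxA (ip_self_adjoint _ _ Mg).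
have n1 : 0 < n%:R - 1 :> R by rewrite subr_gt0 ltr1n.
have kpos : 0 < k.
  rewrite lt_neqAle eq_sym k0 /=; have := tr_sq _ (Ag (p (Ordinal n2)) Ux).
  by rewrite trAA// p_orth eqxx mulr1 pmulr_lge0.
have gU : g x \in unitmx.
  have PU : P *m g x \in unitmx by have [] := mulmx1_unit PgP.
  by move: PU; rewrite unitmx_mul => /andP[].
(* By the total symmetry of nabla A, the pairing of this sum with [w] and [z] is the trace of
   [E w z x]. *)
have S0 : \sum_i E (p i) (p i) x = 0.
  apply: mulmx_ext => w; rewrite mulmx0; apply: (ip_inj gU) => z; rewrite ip0l.
  rewrite mulmx_sumr ip_suml -[RHS](trE w z Ux) tr_p; apply: eq_bigr => i _.
  rewrite (E_swap (p i) (p i) w Ux) (ip_self_adjoint _ _ (Eg (p i) w Ux)).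
  rewrite (EC (p i) w Ux) (E_swap w (p i) z Ux) (ipC _ _ (gT Ux)).
  by rewrite (E_swap w z).
(* With these arguments the first trace sums to zero by [S0], and the second, the square of a
   self-adjoint operator up to [EC], sums to |nabla A|^2. *)
have I i j := simons_identity (p j) (p i) (p i) (p j) Ux.
have SI : \sum_i \sum_j (\tr (E (p i) (p i) x *m E (p j) (p j) x)
   - \tr (E (p j) (p i) x *m E (p j) (p i) x)) =
   \sum_(i < n) \sum_(j < n) (k * (n%:R + 1) * (h x * (1 - (i == j)%:R))).
  apply: eq_bigr => i _; apply: eq_bigr => j _.
  by have := I i j; rewrite (EC (p i) (p j) Ux) !p_orth !eqxx mulr1 (eq_sym j) => ->;
    case: eqP => _; rewrite ?mulr1 ?mulr0.
have S1 : \sum_i \sum_j \tr (E (p i) (p i) x *m E (p j) (p j) x) = 0.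
  under eq_bigr do rewrite -raddf_sum -mulmx_sumr S0 mulmx0 raddf0.
  by rewrite big1.
have S2 : 0 <= \sum_i \sum_j \tr (E (p j) (p i) x *m E (p j) (p i) x).
  by apply: sumr_ge0 => i _; apply: sumr_ge0 => j _; exact/tr_sq/Eg.
have S3 : \sum_(i < n) \sum_(j < n) (k * (n%:R + 1) * (h x * (1 - (i == j)%:R))) =
    k * (n%:R + 1) * (n%:R * (n%:R - 1)) * h x.
  have Si (i : 'I_n) : \sum_(j < n) (k * (n%:R + 1) * (h x * (1 - (i == j)%:R))) =
      k * (n%:R + 1) * (h x * (n%:R - 1)).
    rewrite -mulr_sumr -mulr_sumr sumrB sumr_const card_ord (bigD1 i)//= eqxx big1 ?addr0//.
    by move=> j /negPf ji; rewrite eq_sym ji.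
  rewrite (eq_bigr _ (fun i _ => Si i)) sumr_const card_ord -[LHS]mulr_natr; ring.
move: SI; rewrite S3 (eq_bigr _ (fun i _ => sumrB _ _ _ _)) sumrB S1 sub0r => E0.
have pos : 0 < k * (n%:R + 1) * (n%:R * (n%:R - 1)).
  by rewrite !mulr_gt0// ?ltr0n ?(leq_trans _ n2)// ltr_wpDl// ler0n.
by rewrite -(pmulr_rle0 _ pos) -E0 oppr_le0.
Qed.

End Simons.

(** * The submanifold in charts *)

Lemma ip_ext (R : realType) d (A B : 'M[R]_d) : (forall u v, ip A u v = ip B u v) -> A = B.
Proof.
move=> E; apply/matrixP => i j; have := E (delta_mx 0 i) (delta_mx 0 j).
by rewrite !ipE !trmx_delta -!rowE -!colE !mxE.
Qed.

HB.lock Definition jac (R : realType) n d (F : 'rV[R]_n -> 'rV[R]_d) x : 'M[R]_(n, d) :=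
  'J F x.

HB.lock Definition first_form (R : realType) n d (G : 'rV[R]_d -> 'M[R]_d)
  (F : 'rV[R]_n -> 'rV[R]_d) x : 'M[R]_n := jac F x *m G (F x) *m (jac F x)^T.

(* [w *m tangent_mx G F x] are the components of the tangential part of [w]. *)
HB.lock Definition tangent_mx (R : realType) n d (G : 'rV[R]_d -> 'M[R]_d)
  (F : 'rV[R]_n -> 'rV[R]_d) x : 'M[R]_(d, n) :=
  G (F x) *m (jac F x)^T *m invmx (first_form G F x).

(** The ambient derivative nabla_r X_u before it is split: its tangential part is the induced
    connection, its normal part the second fundamental form. *)
HB.lock Definition hess (R : realType) n d (G : 'rV[R]_d -> 'M[R]_d)
  (F : 'rV[R]_n -> 'rV[R]_d) r u x : 'rV[R]_d := cov G F r (fun y => u *m jac F y) x.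

HB.lock Definition hess_mx (R : realType) n d (G : 'rV[R]_d -> 'M[R]_d)
  (F : 'rV[R]_n -> 'rV[R]_d) r x : 'M[R]_(n, d) :=
  \matrix_(i < n) hess G F r (delta_mx 0 i) x.

(** The Levi-Civita connection of M, taken as the tangential part of the ambient one; its symmetry
    and metric compatibility are [induced_chr_sym] and [der_first_form]. *)
HB.lock Definition induced_chr (R : realType) n d (G : 'rV[R]_d -> 'M[R]_d)
  (F : 'rV[R]_n -> 'rV[R]_d) r x : 'M[R]_n := hess_mx G F r x *m tangent_mx G F x.

(* [u *m shape G K F r x] is the vector [A_r u] with
   <A_r u, w> = <h(r, u), K w>: the shape operator of the normal vector [K r]. *)
HB.lock Definition shape (R : realType) n d (G K : 'rV[R]_d -> 'M[R]_d)
  (F : 'rV[R]_n -> 'rV[R]_d) r x : 'M[R]_n :=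
  - (hess_mx G F r x *m K (F x) *m tangent_mx G F x).

Section Submanifold.
Context (R : realType) (n d : nat) (O : set 'rV[R]_d) (U : set 'rV[R]_n).
Variables (G K : 'rV[R]_d -> 'M[R]_d) (F : 'rV[R]_n -> 'rV[R]_d) (c : R).
Implicit Types (x r s u v w : 'rV[R]_n).
Hypotheses (oO : open O) (CG : smooth_on O G)
  (symG : forall y, O y -> (G y)^T = G y)
  (posG : forall y a, O y -> a != 0 -> 0 < ip (G y) a a)
  (CK : smooth_on O K) (KK : forall y, O y -> K y *m K y = - 1%:M)
  (Kiso : forall y a b, O y -> ip (G y) (a *m K y) (b *m K y) = ip (G y) a b)
  (Kpar : forall y a b, O y ->
    der a (fun z => b *m K z) y + chr G y a (b *m K y) - chr G y a b *m K y = 0)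
  (hol : forall y a, O y ->
    ip (G y) (curvature G y a (a *m K y) (a *m K y)) a = c * ip (G y) a a ^+ 2)
  (oU : open U) (CF : smooth_on U F) (UO : forall x, U x -> O (F x))
  (immF : forall x, U x -> row_free (jac F x)).

Local Notation J := (jac F).
Local Notation g := (first_form G F).
Local Notation T := (tangent_mx G F).
Local Notation h0 := (hess G F).
Local Notation H := (hess_mx G F).
Local Notation N := (induced_chr G F).
Local Notation A := (shape G K F).
Local Notation ipF x := (ip (G (F x))).
Local Notation X u x := (u *m jac F x).
Local Notation XK u x := (u *m jac F x *m K (F x)).

Lemma der_jac u x : U x -> der u F x = X u x.
Proof.
by move=> Ux; rewrite derE [jac]unlock deriveEjacobian//; exact: smooth_differentiable Ux.
Qed.

Lemma smooth_jac : smooth_on U J.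
Proof. by rewrite [jac]unlock; exact: smooth_jacobian. Qed.

Let CX u : smooth_on U (fun x => X u x).
Proof. exact: (smooth_mulmx oU (smooth_cst U u) smooth_jac). Qed.

Let CKF : smooth_on U (fun x => K (F x)).
Proof. exact: (smooth_comp oU oO UO CF CK). Qed.

Let CGF : smooth_on U (fun x => G (F x)).
Proof. exact: (smooth_comp oU oO UO CF CG). Qed.

Let CXK u : smooth_on U (fun x => XK u x).
Proof. exact: (smooth_mulmx oU (CX u) CKF). Qed.

Lemma smooth_first_form : smooth_on U g.
Proof.
rewrite [first_form]unlock.
exact: (smooth_mulmx oU (smooth_mulmx oU smooth_jac CGF) (smooth_trmx oU smooth_jac)).
Qed.
Let Cg := smooth_first_form.

Lemma first_form_sym x : U x -> (g x)^T = g x.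
Proof.
by move=> Ux; rewrite [first_form]unlock !trmx_mul trmxK (symG (UO Ux)) mulmxA.
Qed.
Let gT := first_form_sym.

Lemma ip_first_form x u v : ip (g x) u v = ipF x (X u x) (X v x).
Proof. by rewrite [first_form]unlock ip_mulmx. Qed.

Lemma first_form_gt0 x u : U x -> u != 0 -> 0 < ip (g x) u u.
Proof.
move=> Ux u0; rewrite ip_first_form; apply: (posG (UO Ux)).
by rewrite mulmx_free_eq0 ?immF.
Qed.

Lemma first_form_unit x : U x -> g x \in unitmx.
Proof. by move=> Ux; apply: posdef_unitmx => u; exact: first_form_gt0. Qed.
Let gU := first_form_unit.

Let CT : smooth_on U T.
Proof.
rewrite [tangent_mx]unlock.
apply: (smooth_mulmx oU (smooth_mulmx oU CGF (smooth_trmx oU smooth_jac))).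
exact: (smooth_invmx oU gU Cg).
Qed.

Lemma ip_tangent_mx x a u : U x -> ip (g x) (a *m T x) u = ipF x a (X u x).
Proof.
move=> Ux; rewrite [tangent_mx]unlock !ipE trmx_mul !mulmxA.
by rewrite -[a *m _ *m _ *m invmx _ *m _]mulmxA mulVmx ?gU// mulmx1.
Qed.

Let cov_eq r (xi eta : 'rV[R]_n -> 'rV[R]_d) x : (forall y, U y -> xi y = eta y) -> U x ->
  cov G F r xi x = cov G F r eta x.
Proof. by move=> E Ux; rewrite !covE (der_eq oU r E Ux) E. Qed.

Let hessE r u x : h0 r u x = cov G F r (fun y => X u y) x.
Proof. by rewrite unlock. Qed.

Lemma hess_sym r u x : U x -> h0 r u x = h0 u r x.
Proof.
move=> Ux; rewrite !hessE -(cov_eq r (fun y Uy => der_jac u Uy) Ux).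
rewrite (cov_torsion oO CG symG posG oU CF UO r u Ux).
exact: (cov_eq u (fun y Uy => der_jac r Uy) Ux).
Qed.

Lemma cov_tangent r (z : 'rV[R]_n -> 'rV[R]_n) x : smooth_on U z -> U x ->
  cov G F r (fun y => z y *m J y) x = der r z x *m J x + h0 r (z x) x.
Proof.
move=> Cz Ux; have CJ := smooth_jac; rewrite hessE !covE (der_mulmx r Cz CJ Ux).
by rewrite (der_mulmx r (smooth_cst U (z x)) CJ Ux) der_cst mul0mx add0r addrA.
Qed.

Lemma hess_mulmx r u x : U x -> h0 r u x = u *m H r x.
Proof.
move=> Ux; have L a v w : h0 r (a *: v + w) x = a *: h0 r v x + h0 r w x.
  have CJ := smooth_jac; have [_ Br] := chr_bilin oO CG symG posG (UO Ux).
  rewrite !hessE !covE !(der_mulmx r (smooth_cst U _) CJ Ux) !der_cst !mul0mx !add0r.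
  by rewrite !mulmxDl -!scalemxAl Br scalerDr addrACA.
rewrite (@lin_row_sum R n _ (fun v => h0 r v x) u L) mulmx_sum_row [hess_mx]unlock.
by apply: eq_bigr => i _; rewrite rowK.
Qed.

Let Ch0 r u : smooth_on U (h0 r u).
Proof.
have := smooth_cov oO CG symG posG oU CF UO r (CX u).
by apply: (smooth_eq oU) => x _; rewrite hessE.
Qed.

Let CH r : smooth_on U (H r).
Proof.
apply/(smooth_mx oU) => i j; have := (smooth_mx oU _).1 (Ch0 r (delta_mx 0 i)) 0 j.
by apply: (smooth_eq oU) => x _; rewrite [hess_mx]unlock mxE.
Qed.

Lemma smooth_induced_chr r : smooth_on U (N r).
Proof. by rewrite [induced_chr]unlock; exact: (smooth_mulmx oU (CH r) CT). Qed.

Lemma smooth_shape r : smooth_on U (A r).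
Proof.
rewrite [shape]unlock.
exact: (smoothN oU (smooth_mulmx oU (smooth_mulmx oU (CH r) CKF) CT)).
Qed.

Lemma ip_induced_chr r u w x : U x -> ip (g x) (u *m N r x) w = ipF x (h0 r u x) (X w x).
Proof.
by move=> Ux; rewrite [induced_chr]unlock mulmxA -hess_mulmx// ip_tangent_mx.
Qed.
Let ip_N := ip_induced_chr.

Let ipK x a b : U x -> ipF x (a *m K (F x)) b = - ipF x a (b *m K (F x)).
Proof. by move=> Ux; exact: (ip_cplx_skew KK Kiso _ _ (UO Ux)). Qed.

(** The minus sign in [shape] comes from moving the skew endomorphism [K] from one factor to the
    other. *)
Lemma ip_shape r u w x : U x -> ip (g x) (u *m A r x) w = ipF x (h0 r u x) (XK w x).
Proof.
move=> Ux; rewrite [shape]unlock mulmxN ipNl !mulmxA -hess_mulmx//.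
by rewrite ip_tangent_mx// ipK// opprK.
Qed.
Let ip_A := ip_shape.

Let ipFC x a b : U x -> ipF x a b = ipF x b a.
Proof. by move=> Ux; apply: ipC; exact: (symG (UO Ux)). Qed.

Hypothesis real : forall x u v, U x -> ipF x (XK u x) (X v x) = 0.

Lemma cov_XK r w x : U x -> cov G F r (fun y => XK w y) x = h0 r w x *m K (F x).
Proof.
move=> Ux; rewrite hessE.
exact: (cov_cplx oO CK Kpar r oU CF UO (CX w) Ux).
Qed.

Let der_ipF r (xi eta : 'rV[R]_n -> 'rV[R]_d) x :
  smooth_on U xi -> smooth_on U eta -> U x ->
  der r (fun y => ipF y (xi y) (eta y)) x =
  ipF x (cov G F r xi x) (eta x) + ipF x (xi x) (cov G F r eta x).
Proof. exact: (der_ip_along oO CG symG posG oU CF UO). Qed.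

(** Differentiate <J X_u, X_w> = 0 along [r]; J is parallel and skew. *)
Lemma cubic_form_sym r u w x : U x -> ipF x (h0 r u x) (XK w x) = ipF x (h0 r w x) (XK u x).
Proof.
move=> Ux; have := der_ipF r (CXK u) (CX w) Ux.
rewrite (der_eq (g := fun=> 0) oU r _ Ux) ?der_cst; last by move=> y Uy; exact: real.
rewrite cov_XK// ipK// [ipF x (XK u x) _]ipFC// -hessE => /eqP.
by rewrite eq_sym addrC subr_eq0 => /eqP.
Qed.

Let ip_shapeC r u v x : U x -> ip (g x) (u *m A r x) v = ip (g x) u (v *m A r x).
Proof. by move=> Ux; rewrite (ipC u _ (gT Ux)) !ip_A// cubic_form_sym. Qed.

Lemma shape_self_adjoint r x : U x -> A r x *m g x = g x *m (A r x)^T.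
Proof.
move=> Ux; apply: ip_ext => u v.
by have := ip_shapeC r u v Ux; rewrite !ipE trmx_mul !mulmxA.
Qed.

Lemma shape_sym u v x : U x -> u *m A v x = v *m A u x.
Proof.
move=> Ux; apply: (ip_inj (gU Ux)) => w.
by rewrite !ip_A// hess_sym.
Qed.

Lemma induced_chr_sym u v x : U x -> u *m N v x = v *m N u x.
Proof.
move=> Ux; apply: (ip_inj (gU Ux)) => w.
by rewrite !ip_N// hess_sym.
Qed.

Lemma der_first_form s x : U x -> der s g x = N s x *m g x + g x *m (N s x)^T.
Proof.
move=> Ux; apply: ip_ext => u v.
have := der_ip s Cg (smooth_cst U u) (smooth_cst U v) Ux.
rewrite (der_cst u) (der_cst v) ip0l ip0r !addr0 => <-.
rewrite (der_eq oU s (fun y _ => ip_first_form y u v) Ux) (der_ipF s (CX u) (CX v) Ux).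
rewrite -!hessE [ipF x (X u x) _]ipFC// -!ip_N// ipDG.
by rewrite (ipC _ u (gT Ux)) !ipE trmx_mul !mulmxA.
Qed.

Let normal x (a : 'rV[R]_d) := a - a *m T x *m J x.
Local Notation B u v x := (normal x (h0 u v x)).

Let normal_partE x a : normal_part G F x a = normal x a.
Proof.
by rewrite /normal_part /tangential_part /induced_metric /normal [tangent_mx]unlock
  [first_form]unlock [jac]unlock !mulmxA.
Qed.

Let normalD x a b : normal x (a + b) = normal x a + normal x b.
Proof. by rewrite /normal !mulmxDl opprD addrACA. Qed.

Let normalB x a b : normal x (a - b) = normal x a - normal x b.
Proof.
by rewrite /normal !mulmxBl; apply/rowP => l; rewrite !(mxDE, mxNE); ring.
Qed.

Let tangent_jac x (z : 'rV[R]_n) : U x -> z *m J x *m T x = z.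
Proof.
by move=> Ux; apply: (ip_inj (gU Ux)) => u; rewrite ip_tangent_mx// -ip_first_form.
Qed.

Let normal_tangent x (z : 'rV[R]_n) : U x -> normal x (z *m J x) = 0.
Proof. by move=> Ux; rewrite /normal tangent_jac// subrr. Qed.

Let tangent_XK x u : U x -> XK u x *m T x = 0.
Proof.
by move=> Ux; apply: (ip_inj (gU Ux)) => v; rewrite ip_tangent_mx// real// ip0l.
Qed.

Let normal_X x a w : U x -> ipF x (normal x a) (X w x) = 0.
Proof.
by move=> Ux; rewrite /normal ipBl -ip_first_form -ip_tangent_mx// subrr.
Qed.

Let ip_XXK x u v : U x -> ipF x (X u x) (XK v x) = 0.
Proof. by move=> Ux; rewrite ipFC// real. Qed.

Let normal_XK x a w : U x -> ipF x (normal x a) (XK w x) = ipF x a (XK w x).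
Proof. by move=> Ux; rewrite /normal ipBl ip_XXK// subr0. Qed.

Let ip_XKXK x u v : U x -> ipF x (XK u x) (XK v x) = ip (g x) u v.
Proof. by move=> Ux; rewrite (Kiso _ _ (UO Ux)) ip_first_form. Qed.

(** Every term of [const_hol_curvature] containing J has a factor <J X, X>, zero because M is
    totally real. The result is tangent, hence invisible to the Codazzi equation. *)
Let curvature_X s r u x : U x -> curvature G (F x) (X s x) (X r x) (X u x) =
  (c / 4) *: (ip (g x) r u *: X s x - ip (g x) s u *: X r x).
Proof.
move=> Ux; have Oy := UO Ux.
rewrite (const_hol_curvature oO CG symG posG CK KK Kiso Kpar _ _ _ Oy (fun a => hol a Oy)).
by rewrite !real// ip_XXK// !ip_first_form mulr0 !scale0r subr0 !addr0.
Qed.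

Let curvature_XK s r u x : U x -> curvature G (F x) (X s x) (X r x) (XK u x) =
  (c / 4) *: (ip (g x) r u *: XK s x - ip (g x) s u *: XK r x).
Proof.
move=> Ux; rewrite (curvature_cplx oO CG symG posG CK Kpar _ _ _ (UO Ux)) curvature_X//.
by rewrite -scalemxAl mulmxBl -!scalemxAl.
Qed.

(** * The Ricci equation and the structure of the second fundamental form *)

Hypothesis flat : forall xi, normal_field G F U xi ->
  forall x u v, U x -> normal_curvature G F u v xi x = 0.

Let normal_connectionE u xi x : normal_connection G F u xi x = normal x (cov G F u xi x).
Proof. by rewrite /normal_connection normal_partE [cov]unlock. Qed.

(** The normal curvature of J X_w is the normal part of the ambient curvature corrected by the
    derivatives of the tangential parts removed along the way. *)
Lemma ricci_equation r s w x : U x ->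
  (c / 4) *: (ip (g x) r w *: XK s x - ip (g x) s w *: XK r x) =
  B r (w *m A s x) x - B s (w *m A r x) x.
Proof.
move=> Ux; pose xi y := XK w y.
have nf : normal_field G F U xi.
  split=> [|y u Uy]; first exact: CXK.
  have := real w u Uy; rewrite -(der_jac u Uy) derE [ip]unlock; exact.
have tA a y : U y -> h0 a w y *m K (F y) *m T y = - (w *m A a y).
  by move=> Uy; rewrite [shape]unlock mulmxN opprK hess_mulmx// !mulmxA.
(* By [tA] the tangential part of nabla_a (J X_w) is - X_(A_a w), so projecting adds X_(A_a w). The
   second fundamental form of this tangent field yields the [B] terms. *)
have E1 a y : U y -> normal_connection G F a xi y =
    cov G F a xi y + (w *m A a y) *m J y.
  by move=> Uy; rewrite normal_connectionE /normal cov_XK// tA// mulNmx opprK.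
have CwA a : smooth_on U (fun y => w *m A a y).
  exact: (smooth_mulmx oU (smooth_cst U w) (smooth_shape a)).
have E2 a b : normal_connection G F a (normal_connection G F b xi) x =
    normal x (cov G F a (cov G F b xi) x) + B a (w *m A b x) x.
  rewrite normal_connectionE (cov_eq a (E1 b) Ux).
  have Cb : smooth_on U (cov G F b xi).
    exact: (smooth_cov oO CG symG posG oU CF UO b (CXK w)).
  have CA : smooth_on U (fun y => w *m A b y *m J y).
    exact: (smooth_mulmx oU (CwA b) smooth_jac).
  rewrite (covD oO CG symG posG UO a Cb CA Ux) (cov_tangent a (CwA b) Ux).
  by rewrite !normalD normal_tangent// add0r.
have := flat nf s r Ux; rewrite /normal_curvature !E2 => E3.
have := cov_curvature oO CG symG posG oU CF UO s r (CXK w) Ux.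
rewrite !der_jac// curvature_XK// => /(congr1 (normal x)); rewrite normalB => E4.
have E5 : normal x ((c / 4) *: (ip (g x) r w *: XK s x - ip (g x) s w *: XK r x)) =
   (c / 4) *: (ip (g x) r w *: XK s x - ip (g x) s w *: XK r x).
  have T0 : (c / 4) *: (ip (g x) r w *: XK s x - ip (g x) s w *: XK r x) *m T x = 0.
    by rewrite -scalemxAl mulmxBl -!scalemxAl !tangent_XK// !scaler0 subr0 scaler0.
  by rewrite /normal T0 mul0mx subr0.
rewrite -E5 -E4; apply/eqP; rewrite -subr_eq0; apply/eqP; rewrite -{}E3.
by apply/rowP => l; rewrite !(mxDE, mxNE); ring.
Qed.

Hypotheses (n2 : (2 <= n)%N) (c0 : c != 0)
  (umb : forall x u v, U x ->
    inner (G (F x)) (second_fundamental_form G F x u v) (mean_curvature_vector G F x) =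
    mean_curvature G F x ^+ 2 * inner (induced_metric G F x) u v).
Local Notation zeta x := (mean_curvature_vector G F x).

Let second_formE x u v : U x -> second_fundamental_form G F x u v = B u v x.
Proof.
move=> Ux; rewrite /second_fundamental_form normal_partE hessE; congr normal.
rewrite -(cov_eq u (fun y Uy => der_jac v Uy) Ux) derE [cov]unlock.
by [].
Qed.

Let umbilic x u v : U x -> ipF x (B u v x) (zeta x) = ipF x (zeta x) (zeta x) * ip (g x) u v.
Proof.
move=> Ux; have := umb u v Ux; rewrite second_formE// /mean_curvature.
have -> : induced_metric G F x = g x.
  by rewrite [first_form]unlock [jac]unlock.
rewrite sqr_sqrtr; first by rewrite [ip]unlock.
have [->|z0] := eqVneq (zeta x) 0; first by rewrite /inner mul0mx mul0mx mxE.
by have := posG (UO Ux) z0; rewrite [ip]unlock => /ltW.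
Qed.

Section Structure.
Variables (x : 'rV[R]_n) (P : 'M[R]_n).
Hypotheses (Ux : U x) (PgP : P *m g x *m P^T = 1%:M).
Let p i : 'rV[R]_n := row i P.

Let p_orth i j : ip (g x) (p i) (p j) = (i == j)%:R.
Proof. by rewrite ip_row PgP mxE. Qed.

Let PP : g x *m P^T *m P = 1%:M.
Proof. by apply: mulmx1C; rewrite mulmxA. Qed.

Let p_span u : u = \sum_i ip (g x) u (p i) *: p i.
Proof.
rewrite -[LHS]mulmx1 -PP !mulmxA mulmx_sum_row; apply: eq_bigr => i _; congr (_ *: _).
by rewrite -[u in RHS](row_id 0) ip_row.
Qed.

Let zetaE : n%:R *: zeta x = \sum_i B (p i) (p i) x.
Proof.
have n0 : n%:R != 0 :> R by rewrite pnatr_eq0 -lt0n (leq_trans _ n2).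
rewrite /mean_curvature_vector scalerA divff// scale1r.
have -> : induced_metric G F x = g x by rewrite [first_form]unlock [jac]unlock.
(* This turns the trace taken with the inverse metric into a sum over the orthonormal frame. *)
have -> : invmx (g x) = P^T *m P.
  by apply: (can_inj (mulKmx (gU Ux))); rewrite mulmxV ?gU// mulmxA PP.
have Bb : bilin (fun u v => B u v x).
  have Br a u v w : B u (a *: v + w) x = a *: B u v x + B u w x.
    rewrite !(hess_mulmx u _ Ux) mulmxDl -scalemxAl normalD; congr (_ + _).
    by rewrite /normal -!scalemxAl scalerBr.
  by split=> // a u u' w; rewrite !(hess_sym _ w Ux).
under [RHS]eq_bigr do rewrite (bilin_expand _ _ Bb).
rewrite [RHS]exchange_big; apply: eq_bigr => a _; rewrite [RHS]exchange_big; apply: eq_bigr => b _.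
rewrite mxE scaler_suml; apply: eq_bigr => i _.
by rewrite second_formE// !mxE.
Qed.

Lemma structure_equations :
  [/\ forall u v, h0 u v x = X (v *m N u x) x + XK (v *m A u x) x + ip (g x) u v *: zeta x,
    forall u, ipF x (zeta x) (X u x) = 0, forall u, ipF x (zeta x) (XK u x) = 0,
    forall r s w, w *m (A s x *m A r x - A r x *m A s x) =
       (c / 4) *: (ip (g x) r w *: s - ip (g x) s w *: r) &
    forall r, \tr (A r x) = 0].
Proof.
have k0 : c / 4 != 0 by rewrite mulf_neq0// invr_eq0 pnatr_eq0.
have h1 (a b : 'rV[R]_d) : ipF x a b = ipF x b a by exact: ipFC.
have h2 (a b e : 'rV[R]_d) : ipF x (a + b) e = ipF x a e + ipF x b e by exact: ipDl.
have h3 t (a e : 'rV[R]_d) : ipF x (t *: a) e = t * ipF x a e by exact: ipZl.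
have h4 (a : 'rV[R]_d) : a != 0 -> 0 < ipF x a a by exact: (posG (UO Ux)).
have h5 (a b : 'rV[R]_d) : ipF x (a *m K (F x)) (b *m K (F x)) = ipF x a b.
  exact: (Kiso _ _ (UO Ux)).
have h6 (a b : 'rV[R]_d) : ipF x (a *m K (F x)) b = - ipF x a (b *m K (F x)) by exact: ipK.
have h7 (u v : 'rV[R]_n) : X (u + v) x = X u x + X v x by exact: mulmxDl.
have h8 t (u : 'rV[R]_n) : X (t *: u) x = t *: X u x by rewrite -scalemxAl.
have h9 u v : ipF x (XK u x) (X v x) = 0 by exact: real.
have h10 u : u = \sum_i ipF x (X u x) (X (p i) x) *: p i.
  by rewrite {1}[u]p_span; apply: eq_bigr => i _; rewrite ip_first_form.
have h11 i j : ipF x (X (p i) x) (X (p j) x) = (i == j)%:R.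
  by rewrite -ip_first_form p_orth.
have h12 u v : B u v x = B v u x by rewrite hess_sym.
have h13 u u' v : B (u + u') v x = B u v x + B u' v x.
  by rewrite !(hess_sym _ v Ux) !hess_mulmx// mulmxDl normalD.
have h14 t u v : B (t *: u) v x = t *: B u v x.
  by rewrite !(hess_sym _ v Ux) !hess_mulmx// -scalemxAl /normal -!scalemxAl scalerBr.
have h15 u v w : ipF x (B u v x) (X w x) = 0 by exact: normal_X.
have h16 u v w : ipF x (B u v x) (XK w x) = ipF x (B u w x) (XK v x).
  by rewrite !normal_XK// cubic_form_sym.
have h17 u v w : ipF x (X (v *m A u x) x) (X w x) = ipF x (B u v x) (XK w x).
  by rewrite -ip_first_form ip_A// normal_XK.
have h18 r s w : (c / 4) *: (ipF x (X r x) (X w x) *: XK s x - ipF x (X s x) (X w x) *: XK r x) =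
     B r (w *m A s x) x - B s (w *m A r x) x.
  by rewrite -!ip_first_form ricci_equation.
have h19 := zetaE.
have h20 u v : ipF x (B u v x) (zeta x) = ipF x (zeta x) (zeta x) * ipF x (X u x) (X v x).
  by rewrite umbilic// ip_first_form.
have dec := @second_form_decomposition R n _ _ (ip (G (F x))) (fun a => a *m K (F x))
  (fun u => X u x) (fun u v => B u v x) (fun u v => v *m A u x) p (zeta x) (c / 4)
  h1 h2 h3 h4 h5 h6 h7 h8 h9 h10 h11 h12 h13 h14 h15 h16 h17 h18 h19 h20 n2 k0.
have perp := @mean_curvature_perp R n _ _ (ip (G (F x))) (fun a => a *m K (F x))
  (fun u => X u x) (fun u v => B u v x) (fun u v => v *m A u x) p (zeta x) (c / 4)
  h1 h2 h3 h6 h7 h8 h10 h11 h12 h16 h17 h18 h20 n2 k0.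
have brk := @ricci_bracket R n _ _ (ip (G (F x))) (fun a => a *m K (F x))
  (fun u => X u x) (fun u v => B u v x) (fun u v => v *m A u x) p (c / 4)
  h2 h3 h5 h7 h8 h10 h17 h18.
have trl := @shape_traceless R n _ _ (ip (G (F x))) (fun a => a *m K (F x))
  (fun u => X u x) (fun u v => B u v x) (fun u v => v *m A u x) p (zeta x) (c / 4)
  h1 h2 h3 h6 h7 h8 h10 h11 h12 h16 h17 h18 h19 h20 n2 k0.
split.
- move=> u v; have := dec u v; rewrite -ip_first_form => E.
  have -> : X (v *m N u x) x = h0 u v x *m T x *m J x.
    by rewrite [induced_chr]unlock mulmxA -hess_mulmx.
  by rewrite -addrA -E /normal addrC subrK.
- move=> u; have n0 : n%:R != 0 :> R by rewrite pnatr_eq0 -lt0n (leq_trans _ n2).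
  apply: (mulfI n0); rewrite -ipZl zetaE ip_suml mulr0 big1// => i _; exact: normal_X.
- by move=> u; exact: perp.
- by move=> r s w; have := brk r s w; rewrite mulmxBr !mulmxA -!ip_first_form.
- move=> r; rewrite (mxtrace_orthonormal _ PgP) -[RHS](trl r).
  by apply: eq_bigr => i _; rewrite ip_first_form.
Qed.

End Structure.

Let structure x : U x -> [/\
    forall u v, h0 u v x = X (v *m N u x) x + XK (v *m A u x) x + ip (g x) u v *: zeta x,
    forall u, ipF x (zeta x) (X u x) = 0, forall u, ipF x (zeta x) (XK u x) = 0,
    forall r s w, w *m (A s x *m A r x - A r x *m A s x) =
       (c / 4) *: (ip (g x) r w *: s - ip (g x) s w *: r) &
    forall r, \tr (A r x) = 0].
Proof.
move=> Ux; have gpos u : u != 0 -> 0 < (u *m g x *m u^T) 0 0.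
  by rewrite -ipE; exact: first_form_gt0.
have [P PgP] := orthonormal_basis (gT Ux) gpos.
exact: structure_equations Ux PgP.
Qed.

(** * The Codazzi and Gauss equations *)

Let hess_hess r u s w x : U x -> ipF x (h0 r u x) (h0 s w x) =
  ip (g x) (u *m N r x) (w *m N s x) + ip (g x) (u *m A r x) (w *m A s x)
  + ipF x (zeta x) (zeta x) * ip (g x) r u * ip (g x) s w.
Proof.
move=> Ux; have [E zX zK _ _] := structure Ux.
have Xz v : ipF x (X v x) (zeta x) = 0 by rewrite ipFC.
have XKz v : ipF x (XK v x) (zeta x) = 0 by rewrite ipFC.
rewrite !E; move: (zeta x) zX zK Xz XKz => z zX zK Xz XKz; rewrite !(ipDl, ipDr, ipZl, ipZr).
rewrite !(zX, zK, Xz, XKz, ip_XKXK _ _ Ux, real _ _ Ux, ip_XXK _ _ Ux) -!ip_first_form.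
by ring.
Qed.

(** K exchanges the X and JX components up to sign, and [zeta] times K is orthogonal to X, to JX and
    to [zeta]. So [zeta] drops out, and with it any trace of [zeta] in the Codazzi equation. *)
Let hess_hessK r u s w x : U x -> ipF x (h0 r u x) (h0 s w x *m K (F x)) =
  - ip (g x) (u *m N r x) (w *m A s x) + ip (g x) (u *m A r x) (w *m N s x).
Proof.
move=> Ux; have [E zX zK _ _] := structure Ux.
have XKK v : XK v x *m K (F x) = - X v x by rewrite -mulmxA (KK (UO Ux)) mulmxN mulmx1.
have zz : ipF x (zeta x) (zeta x *m K (F x)) = 0.
  by have := ipK (zeta x) (zeta x) Ux; rewrite ipFC//; lra.
have XzK v : ipF x (X v x) (zeta x *m K (F x)) = 0.
  by have := ipK (X v x) (zeta x) Ux; rewrite ipFC// zK; lra.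
have XKzK v : ipF x (XK v x) (zeta x *m K (F x)) = 0.
  by rewrite (Kiso _ _ (UO Ux)) ipFC.
rewrite !E !mulmxDl XKK -scalemxAl; move: (zeta x) zX zK zz XzK XKzK {E} => z zX zK zz XzK XKzK.
rewrite !(ipDl, ipDr, ipZl, ipZr, ipNl, ipNr).
rewrite !(zX, zK, zz, XzK, XKzK, ip_XKXK _ _ Ux, real _ _ Ux, ip_XXK _ _ Ux) -!ip_first_form.
by ring.
Qed.

Let der_ip_form s (z : 'rV[R]_n -> 'rV[R]_n) w x : smooth_on U z -> U x ->
  der s (fun y => ip (g y) (z y) w) x =
  ip (g x) (z x *m N s x) w + ip (g x) (z x) (w *m N s x) + ip (g x) (der s z x) w.
Proof.
move=> Cz Ux; rewrite (der_ip s Cg Cz (smooth_cst U w) Ux) (der_cst w) ip0r addr0.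
rewrite der_first_form// ipDG; congr (_ + _ + _).
  by rewrite !ipE !mulmxA.
by rewrite !ipE trmx_mul !mulmxA.
Qed.

Let der_row_mul s (M : 'rV[R]_n -> 'M[R]_n) u x : smooth_on U M -> U x ->
  der s (fun y => u *m M y) x = u *m der s M x.
Proof.
by move=> CM Ux; rewrite (der_mulmx s (smooth_cst U u) CM Ux) (der_cst u) mul0mx add0r.
Qed.

Let CuN u r : smooth_on U (fun y => u *m N r y).
Proof. exact: (smooth_mulmx oU (smooth_cst U u) (smooth_induced_chr r)). Qed.

Let CuA u r : smooth_on U (fun y => u *m A r y).
Proof. exact: (smooth_mulmx oU (smooth_cst U u) (smooth_shape r)). Qed.

Let cov_hess s r u x : U x -> cov G F s (h0 r u) x - cov G F r (h0 s u) x =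
  (c / 4) *: (ip (g x) r u *: X s x - ip (g x) s u *: X r x).
Proof.
move=> Ux; rewrite -curvature_X//.
have := cov_curvature oO CG symG posG oU CF UO s r (CX u) Ux; rewrite !der_jac// => <-.
by congr (_ - _); apply: cov_eq => // y Uy; rewrite hessE.
Qed.

(** The component along J X_w of the ambient curvature identity [cov_hess], whose right side is
    tangent and contributes zero. *)
Lemma codazzi_equation s r x : U x ->
  der s (A r) x + A r x *m N s x + N r x *m A s x =
  der r (A s) x + A s x *m N r x + N s x *m A r x.
Proof.
move=> Ux; apply: mulmx_ext => u; apply: (ip_inj (gU Ux)) => w.
have E a b : ipF x (cov G F a (h0 b u) x) (XK w x) =
    ip (g x) (u *m (der a (A b) x + A b x *m N a x + N b x *m A a x)) w.
  have E1 y : U y -> ip (g y) (u *m A b y) w = ipF y (h0 b u y) (XK w y).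
    by move=> Uy; exact: ip_A.
  have := der_ipF a (Ch0 b u) (CXK w) Ux.
  rewrite -(der_eq oU a E1 Ux) (der_ip_form a w (CuA u b) Ux) cov_XK// hess_hessK//.
  rewrite (der_row_mul a u (smooth_shape b) Ux) !mulmxDr !ipDl !mulmxA.
  by rewrite (ip_shapeC a (u *m N b x) w Ux); lra.
have := cov_hess s r u Ux => /(congr1 (fun a => ipF x a (XK w x))).
rewrite ipBl !E ipZl ipBl !ipZl !ip_XXK// !mulr0 subr0 mulr0.
by move=> /eqP; rewrite subr_eq0 => /eqP.
Qed.

(** The component of [cov_hess] along X_w. The products of shape operators form a bracket, which
    [brk] evaluates to exactly cancel the ambient [c / 4]. *)
Lemma gauss_equation s r u x : U x ->
  u *m (der s (N r) x - der r (N s) x + N r x *m N s x - N s x *m N r x) =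
  ipF x (zeta x) (zeta x) *: (ip (g x) r u *: s - ip (g x) s u *: r).
Proof.
move=> Ux; apply: (ip_inj (gU Ux)) => w; have [_ _ _ brk _] := structure Ux.
set q := ipF x (zeta x) (zeta x); have E a b : ipF x (cov G F a (h0 b u) x) (X w x) =
    ip (g x) (u *m der a (N b) x) w + ip (g x) (u *m N b x *m N a x) w
    - ip (g x) (u *m A b x) (w *m A a x)
    - q * ip (g x) b u * ip (g x) a w.
  have E1 y : U y -> ip (g y) (u *m N b y) w = ipF y (h0 b u y) (X w y).
    by move=> Uy; exact: ip_N.
  have := der_ipF a (Ch0 b u) (CX w) Ux.
  rewrite -(der_eq oU a E1 Ux) (der_ip_form a w (CuN u b) Ux) -hessE hess_hess// -/q.
  rewrite (der_row_mul a u (smooth_induced_chr b) Ux).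
  by clearbody q; lra.
clearbody q; have AA a b : ip (g x) (u *m A b x) (w *m A a x) = ip (g x) (u *m A b x *m A a x) w.
  by rewrite -ip_shapeC.
have := congr1 (fun a => ip (g x) a w) (brk r s u).
rewrite mulmxBr !mulmxA ipBl ipZl ipBl !ipZl => E2.
have := cov_hess s r u Ux => /(congr1 (fun a => ipF x a (X w x))).
rewrite ipBl !E !AA ipZl ipBl !ipZl -!ip_first_form.
rewrite !(mulmxBr, mulmxDr) !mulmxA !(ipBl, ipDl, ipZl); lra.
Qed.

Theorem mean_curvature_eq0 x : U x -> zeta x = 0.
Proof.
move=> Ux; have gpos u : u != 0 -> 0 < (u *m g x *m u^T) 0 0.
  by rewrite -ipE; exact: first_form_gt0.
have [P PgP] := orthonormal_basis (gT Ux) gpos.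
have k0 : c / 4 != 0 by rewrite mulf_neq0// invr_eq0 pnatr_eq0.
(* Linearity in the label is carried over from linearity in the argument by [shape_sym]. *)
have Alin y a r s : U y -> A (a *: r + s) y = a *: A r y + A s y.
  move=> Uy; apply: mulmx_ext => u.
  by rewrite (shape_sym u _ Uy) mulmxDl mulmxDr -scalemxAl -scalemxAr -!(shape_sym u)//.
have gge0 u : 0 <= ip (g x) u u.
  by have [->|/(first_form_gt0 Ux)/ltW//] := eqVneq u 0; rewrite ip0l.
have S1 y r s w : U y -> w *m (A s y *m A r y - A r y *m A s y) =
     (c / 4) *: (ip (g y) r w *: s - ip (g y) s w *: r).
  by move=> /structure[_ _ _ brk _]; exact: brk.
have S2 y r : U y -> \tr (A r y) = 0 by move=> /structure[_ _ _ _ trl]; exact: trl.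
have S3 y u v : U y -> u *m A v y = v *m A u y by exact: shape_sym.
have S4 y u v : U y -> u *m N v y = v *m N u y by exact: induced_chr_sym.
have S5 y r : U y -> A r y *m g y = g y *m (A r y)^T by exact: shape_self_adjoint.
have S6 y s : U y -> der s g y = N s y *m g y + g y *m (N s y)^T by exact: der_first_form.
have := @simons_bound R n U g A N (c / 4) (fun y => ipF y (zeta y) (zeta y)) oU Cg
  smooth_shape smooth_induced_chr gT Alin S3 S4 S5 S6 S1 S2
  (fun y s r => @codazzi_equation s r y) (fun y s r u => @gauss_equation s r u y)
  x P Ux PgP gge0 n2 k0.
move=> zz; apply/eqP/negP => /negP/(posG (UO Ux)); rewrite ltNge; exact/negP/negPn.
Qed.

End Submanifold.

(** * From charts to the immersion *)

Lemma local_dom_param (R : realType) n d (M : smoothManifold R n) (N : smoothManifold R d)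
    (f : M -> N) i j x : local_dom f i j x <->
  codom_chart i x /\ dom j (f (param i x)).
Proof.
split=> [[q [qi qj] <-]|[[q qi <-]]]; first by rewrite chartK//; split=> //; exists q.
by rewrite chartK// => qj; exists q.
Qed.

Lemma local_dom_open (R : realType) n d (M : smoothManifold R n) (N : smoothManifold R d)
    (f : M -> N) i j : continuous f -> open (local_dom f i j).
Proof.
move=> fc; rewrite openE => x /local_dom_param[xi xj].
have n1 : nbhs x (codom_chart i) by apply: open_nbhs_nbhs; split; [exact: chart_open|].
have n2 : nbhs x [set y | dom j (f (param i y))].
  apply: (continuous_comp (param_continuous xi) (fc (param i x))).
  by apply: open_nbhs_nbhs; split; [exact: dom_open|].
by apply: filterS2 n1 n2 => y yi yj; apply/local_dom_param.
Qed.

Lemma local_expr_codom (R : realType) n d (M : smoothManifold R n) (N : smoothManifold R d)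
    (f : M -> N) i j x : local_dom f i j x -> codom_chart j (local_expr f i j x).
Proof. by move=> /local_dom_param[_ xj]; exists (f (param i x)). Qed.

Lemma kahler_ip_cplx (R : realType) m (N : kahlerManifold R m) (j : chartIndex N) y u :
  codom_chart j y -> ip (metric j y) u (u *m cplx j y) = 0.
Proof.
move=> Oy.
have Kiso z a b : codom_chart j z ->
    ip (metric j z) (a *m cplx j z) (b *m cplx j z) = ip (metric j z) a b.
  by move=> Oz; rewrite [ip]unlock cplx_isometry.
have := ip_cplx_skew (@cplx_sqr _ _ N j) Kiso u u Oy.
by rewrite (ipC _ _ (Defs.metric_sym Oy)); lra.
Qed.

(** Since [a] is orthogonal to its image under J, which has the same length, the denominator of the
    sectional curvature is |a|^4. The cleared form also covers [a = 0]. *)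
Lemma hol_curvature (R : realType) m (N : kahlerManifold R m) c (j : chartIndex N) y a :
  complex_space_form N c -> codom_chart j y ->
  ip (metric j y) (curvature (metric j) y a (a *m cplx j y) (a *m cplx j y)) a =
  c * ip (metric j y) a a ^+ 2.
Proof.
move=> hN Oy; have [->|a0] := eqVneq a 0; first by rewrite !ip0r expr0n mulr0.
have := hN j y a Oy a0; have := metric_pos Oy a0; have := kahler_ip_cplx a Oy.
rewrite /sectional_curvature cplx_isometry// [ip]unlock => -> E0 <-.
by rewrite expr0n subr0 -expr2 divfK// expf_neq0// gt_eqF.
Qed.

(** The bound [2 <= n] excludes curves: these are always totally real and pseudo-umbilical with flat
    normal connection, without being geodesics in general. *)
Theorem theorem1p1 (R : realType) (n p : nat) (c : R)
    (M : smoothManifold R n) (N : kahlerManifold R (n + p)) (f : M -> N)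
    (hn : (2 <= n)%N) (hc : c != 0) (hN : complex_space_form N c)
    (hf : immersion f) (hreal : totally_real f)
    (humb : pseudo_umbilical f) (hflat : flat_normal_connection f) :
  minimal f.
Proof.
move=> i j x Ux; have [fc fS] := hf; have [CF immF] := fS i j.
have CF0 y : local_dom f i j y -> differentiable (local_expr f i j) y.
  by move=> Uy; exact: smooth_differentiable Uy.
apply: (@mean_curvature_eq0 R n _ (codom_chart j) (local_dom f i j) (metric j) (cplx j)
  (local_expr f i j) c) => //.
- exact: chart_open.
- exact: metric_smooth.
- by move=> y; exact: Defs.metric_sym.
- by move=> y a Oy a0; rewrite [ip]unlock; exact: metric_pos.
- exact: cplx_smooth.
- by move=> y; exact: cplx_sqr.
- by move=> y a b Oy; rewrite [ip]unlock cplx_isometry.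
- by move=> y a b Oy; rewrite derE [chr]unlock; exact: cplx_parallel.
- by move=> y a Oy; exact: hol_curvature.
- exact: local_dom_open.
- by move=> y; exact: local_expr_codom.
- by move=> y Uy; rewrite [jac]unlock; exact: immF.
- move=> y u v Uy; have := hreal i j y u v Uy.
  by rewrite /= [ip]unlock [jac]unlock !deriveEjacobian//; exact: CF0.
- by move=> xi nf y u v Uy; exact: (hflat i j).
- by move=> y u v Uy; exact: humb.
Qed.
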